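(* Let $n\ge 2$. For any convex body $K\subset\mathbb{R}^n$ of class $C^2_+$ containing the origin in its interior, the sequence $$\left\{\left(\frac{\Omega_{-(n+2^p)}(K)}{n\,Vol(K^\circ)}\right)^{2^p}\right\}_{p\in\mathbb{N},\ p\ge1}$$ converges and $$\lim_{p\to\infty}\left(\frac{\Omega_{-(n+2^p)}(K)}{n\,Vol(K^\circ)}\right)^{2^p}=\Omega_K^{-1}.$$
   Context: A convex body is of class $C^2_+$ if its boundary is of class $C^2$ with positive Gauss curvature. For such $K$ with the origin in its interior, $h(u)=\max\{x\cdot u:x\in K\}$ is the support function, $\mathcal{K}(u)$ is the Gauss curvature of $\partial K$ at the point with outer unit normal $u\in\mathbb{S}^{n-1}$, the centro-affine curvature is $\mathcal{K}_0(u)=\mathcal{K}(u)/h(u)^{n+1}$, and the cone measure of $\partial K$, in the parametrization by the unit normal, is $d\mu_K=\frac{h}{\mathcal{K}}\,d\mu_{\mathbb{S}^{n-1}}$, where $\mu_{\mathbb{S}^{n-1}}$ is the spherical Lebesgue measure. For real $q\ne -n$ the $q$-affine surface area is $\Omega_q(K)=\int_{\partial K}\mathcal{K}_0^{\frac{q}{n+q}}\,d\mu_K$. $K^\circ=\{y:x\cdot y\le1\ \forall x\in K\}$ is the polar body. The Paouris-Werner invariant is $\Omega_K:=\lim_{q\to\infty}\left(\frac{\Omega_q(K)}{n\,Vol(K^\circ)}\right)^{n+q}$ (limit over real $q$; the limit exists). *)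

(* Defs.v *)
From HB Require Import structures.
From mathcomp Require Import all_boot all_order all_algebra.
From mathcomp Require Import all_classical all_reals all_analysis.
From mathcomp Require Import measurable_realfun.

Set Implicit Arguments.
Unset Strict Implicit.
Unset Printing Implicit Defensive.

Import Order.TTheory GRing.Theory Num.Theory.
Import numFieldNormedType.Exports.

Local Open Scope classical_set_scope.
Local Open Scope ring_scope.

Section euclidean.
Context {R : realType} {n : nat}.
Implicit Types u v : 'rV[R]_n.

Definition dotp u v : R := \sum_(i < n) u 0 i * v 0 i.

(* The library norm `|u| on 'rV[R]_n is the sup norm; it only serves to define
   limits, for which all norms agree. *)
Definition enorm u : R := Num.sqrt (dotp u u).

Definition sphere : set 'rV[R]_n := [set u | enorm u = 1].

Definition normalize u : 'rV[R]_n := (enorm u)^-1 *: u.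

End euclidean.
Arguments sphere : clear implicits.

Definition measure_rV_display : measure_display.
Proof. exact: default_measure_display. Qed.

Section measurable_rV.
Context (R : realType) (n : nat).

Let coor (i : 'I_n) (x : 'rV[R]_n) : measurableTypeR R := x 0 i.

Let rV_set0 : g_sigma_preimage coor set0.
Proof. exact: sigma_algebra0. Qed.

Let rV_setC A : g_sigma_preimage coor A -> g_sigma_preimage coor (~` A).
Proof. exact: sigma_algebraC. Qed.

Let rV_bigcup (F : _^nat) : (forall i, g_sigma_preimage coor (F i)) ->
  g_sigma_preimage coor (\bigcup_i (F i)).
Proof. exact: sigma_algebra_bigcup. Qed.

HB.instance Definition _ := @isMeasurable.Build measure_rV_display
  'rV[R]_n (g_sigma_preimage coor) rV_set0 rV_setC rV_bigcup.

Lemma measurable_coor (i : 'I_n) :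
  measurable_fun [set: 'rV[R]_n] (fun x : 'rV[R]_n => x 0 i : measurableTypeR R).
Proof.
move=> _ Y mY; rewrite setTI; apply: sub_sigma_algebra => /=.
rewrite -bigcup_seq/=; exists i => /=; first by rewrite mem_index_enum.
by exists Y => //; rewrite setTI.
Qed.

Lemma measurable_fun_coorP d (T : measurableType d) (f : T -> 'rV[R]_n) :
  measurable_fun [set: T] f <->
  forall i, measurable_fun [set: T] (fun x => f x 0 i : measurableTypeR R).
Proof.
split=> [mf i|mf].
  exact: (measurableT_comp (measurable_coor i) mf).
have sub : g_sigma_preimage coor `<=` image_set_system setT f measurable.
  apply: smallest_sub; first exact/sigma_algebra_image/sigma_algebra_measurable.
  move=> B; rewrite -bigcup_seq/= => -[i _ [C mC <-]].
  by rewrite /image_set_system /= setTI; exact: mf.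
by move=> _ A /sub.
Qed.

End measurable_rV.

Section lebesgue_measure_rV.
Context {R : realType}.

Definition cons_rV n (p : measurableTypeR R * 'rV[R]_n) : 'rV[R]_n.+1 :=
  row_mx (const_mx p.1 : 'rV[R]_1) p.2.

Definition behead_rV n (x : 'rV[R]_n.+1) : measurableTypeR R * 'rV[R]_n :=
  (x 0 0, rsubmx (x : 'rV[R]_(1 + n))).

Lemma cons_rVK n : cancel (@cons_rV n) (@behead_rV n).
Proof.
move=> [t y]; rewrite /behead_rV /cons_rV /= row_mxKr; congr pair.
by rewrite mxE; case: splitP => // j _; rewrite mxE.
Qed.

Lemma measurable_cons_rV n : measurable_fun setT (@cons_rV n).
Proof.
apply/measurable_fun_coorP => i.
rewrite /cons_rV; case: (@splitP 1 n i) => [j ij|k ik].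
  rewrite (_ : (fun x => _) = fst) //.
  apply/funext => x; rewrite mxE; case: splitP => [j' _|k]; first by rewrite mxE.
  by move=> ik; move: (ltn_ord j); rewrite -ij ik.
rewrite (_ : (fun x => _) = (fun y : 'rV[R]_n => y 0 k : measurableTypeR R) \o snd).
  exact: (measurableT_comp (measurable_coor k)).
apply/funext => x; rewrite mxE; case: splitP => [j|k' ik'] /=.
  by move=> ij; move: (ltn_ord j); rewrite -ij ik.
by congr (x.2 0 _); apply/val_inj; move: ik'; rewrite ik => /eqP; rewrite eqn_add2l => /eqP.
Qed.

Lemma measurable_behead_rV n : measurable_fun setT (@behead_rV n).
Proof.
apply/measurable_fun_pairP; split; first exact: measurable_coor.
apply/measurable_fun_coorP => i.
rewrite (_ : (fun x => _) = (fun x : 'rV[R]_n.+1 => x 0 (rshift 1 i) : measurableTypeR R)).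
  exact: measurable_coor.
by apply/funext => x; rewrite mxE.
Qed.

Definition lebesgue_cons n (m : set 'rV[R]_n -> \bar R) :=
  pushforward (lebesgue_measure \x m)%E (@cons_rV n).

Section instances.
Context (n : nat) (m : {sigma_finite_measure set 'rV[R]_n -> \bar R}).

Let mu := (lebesgue_measure \x m)%E.

Let lebesgue_cons0 : lebesgue_cons m set0 = 0%E.
Proof. by rewrite /lebesgue_cons /pushforward preimage_set0 measure0. Qed.

Let measurable_pre A : measurable A -> measurable (@cons_rV n @^-1` A).
Proof.
by move=> mA; rewrite -[X in measurable X]setTI; apply: measurable_cons_rV.
Qed.

Let lebesgue_cons_ge0 A : (0 <= lebesgue_cons m A)%E.
Proof. by apply: integral_ge0 => x _; exact: measure_ge0. Qed.

Let lebesgue_cons_sigma_additive : semi_sigma_additive (lebesgue_cons m).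
Proof.
move=> F mF tF mUF; rewrite /lebesgue_cons /pushforward preimage_bigcup.
apply: measure_semi_sigma_additive.
- by move=> k; exact: measurable_pre.
- apply/trivIsetP => /= i j _ _ ij; rewrite -preimage_setI.
  by move/trivIsetP : tF => /(_ _ _ _ _ ij) ->//; rewrite preimage_set0.
- by rewrite -preimage_bigcup; exact: measurable_pre.
Qed.

HB.instance Definition _ := isMeasure.Build _ _ _ (lebesgue_cons m)
  lebesgue_cons0 lebesgue_cons_ge0 lebesgue_cons_sigma_additive.

Let lebesgue_cons_sigma_finite : sigma_finite setT (lebesgue_cons m).
Proof.
have /sigma_finiteP[F [TF ndF Foo]] := sigma_finiteT (@lebesgue_measure R).
have /sigma_finiteP[G [TG ndG Goo]] := sigma_finiteT m.
exists (fun k => @behead_rV n @^-1` (F k `*` G k)).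
  rewrite -preimage_bigcup -(preimage_setT (@behead_rV n)); congr (_ @^-1` _).
  rewrite -setXTT TF TG predeqE => -[x y]; split.
    move=> [/= [i _ Fix] [k _ Gky]]; exists (maxn i k) => //; split.
    - by move: x Fix; exact/subsetPset/ndF/leq_maxl.
    - by move: y Gky; exact/subsetPset/ndG/leq_maxr.
  by move=> [i _ []/= ? ?]; split; exists i.
move=> k; have [mF Fk] := Foo k; have [mG Gk] := Goo k; split.
  rewrite -[X in measurable X]setTI; apply: measurable_behead_rV => //.
  exact: measurableX.
rewrite /lebesgue_cons /pushforward.
rewrite (_ : _ @^-1` _ = F k `*` G k).
  by rewrite product_measure1E// lte_mul_pinfty// ge0_fin_numE.
by apply/seteqP; split => p; rewrite /preimage /mkset cons_rVK.
Qed.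

HB.instance Definition _ := Measure_isSigmaFinite.Build _ _ _ (lebesgue_cons m)
  lebesgue_cons_sigma_finite.

End instances.

(* Lebesgue measure on R^n, as the n-fold product of the one-dimensional one. *)
Fixpoint lebesgue_rV n : {sigma_finite_measure set 'rV[R]_n -> \bar R} :=
  match n with
  | 0 => \d_(0 : 'rV[R]_0)
  | k.+1 => lebesgue_cons (lebesgue_rV k)
  end.

Definition vol n (A : set 'rV[R]_n) : R := fine (lebesgue_rV n A).

End lebesgue_measure_rV.

Section spherical_measure.
Context {R : realType} {n : nat}.

Lemma measurable_dotp : measurable_fun setT (fun x : 'rV[R]_n => dotp x x).
Proof.
apply: measurable_sum => i; apply: measurable_funM; exact: measurable_coor.
Qed.

Lemma measurable_enorm : measurable_fun setT (@enorm R n).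
Proof.
rewrite (_ : enorm = (@powR R ^~ 2^-1) \o (fun x => dotp x x)).
  by apply: measurableT_comp; [exact: measurable_powR|exact: measurable_dotp].
apply/funext => x /=; rewrite powR12_sqrt//.
by apply: sumr_ge0 => i _; rewrite -expr2 sqr_ge0.
Qed.

Lemma measurable_normalize : measurable_fun setT (@normalize R n).
Proof.
apply/measurable_fun_coorP => i.
rewrite (_ : (fun x => _) = (fun x => enorm x `^ (-1) * x 0 i)).
  apply: measurable_funM; last exact: measurable_coor.
  exact: (measurableT_comp (measurable_powR _) measurable_enorm).
by apply/funext => x; rewrite mxE powR_inv1// sqrtr_ge0.
Qed.

Definition punctured_ball : set 'rV[R]_n := [set x | 0 < enorm x <= 1].

Lemma measurable_punctured_ball : measurable punctured_ball.
Proof.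
rewrite (_ : punctured_ball = enorm @^-1` `]0, 1]%classic).
  rewrite -[X in measurable X]setTI.
  exact: (measurable_enorm _ (measurable_itv _)).
by apply/seteqP; split => x /=; rewrite in_itv.
Qed.

Definition cone_volume (A : set 'rV[R]_n) : \bar R :=
  lebesgue_rV n (normalize @^-1` A `&` punctured_ball).

Let cone_volume0 : cone_volume set0 = 0%E.
Proof. by rewrite /cone_volume preimage_set0 set0I measure0. Qed.

Let cone_volume_ge0 A : (0 <= cone_volume A)%E.
Proof. exact: measure_ge0. Qed.

Let cone_volume_sigma_additive : semi_sigma_additive cone_volume.
Proof.
have mpre A : measurable A -> measurable (@normalize R n @^-1` A).
  by move=> mA; rewrite -[X in measurable X]setTI; exact: measurable_normalize.
move=> F mF tF mUF; rewrite /cone_volume preimage_bigcup setI_bigcupl.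
apply: measure_semi_sigma_additive.
- by move=> k; apply: measurableI; [exact: mpre|exact: measurable_punctured_ball].
- apply: trivIset_setIr; apply/trivIsetP => /= i j _ _ ij.
  rewrite -preimage_setI.
  by move/trivIsetP : tF => /(_ _ _ _ _ ij) ->//; rewrite preimage_set0.
- rewrite -setI_bigcupl -preimage_bigcup.
  by apply: measurableI; [exact: mpre|exact: measurable_punctured_ball].
Qed.

HB.instance Definition _ := isMeasure.Build _ _ _ cone_volume
  cone_volume0 cone_volume_ge0 cone_volume_sigma_additive.

(* The spherical Lebesgue measure, extended by 0 outside the sphere and
   normalized by polar coordinates dx = r^(n-1) dr dsigma(u): sigma(A) is n times
   the volume of the cone {r u : u in A, 0 < r <= 1}. *)
Definition sphere_measure : set 'rV[R]_n -> \bar R :=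
  mscale (n%:R%:nng : {nonneg R}) cone_volume.

HB.instance Definition _ := Measure.on sphere_measure.

End spherical_measure.

Section convex_bodies.
Context {R : realType} {n : nat}.
Implicit Types (K : set 'rV[R]_n) (x u : 'rV[R]_n).

Definition convex_body K := [/\ compact K, convex_set K & K° !=set0].

Definition boundary K : set 'rV[R]_n := closure K `\` K°.

Definition polar K : set 'rV[R]_n := [set y | forall x, K x -> dotp x y <= 1].

Definition support K u : R := sup [set dotp x u | x in K].

Definition grad (f : 'rV[R]_n -> R) x : 'rV[R]_n :=
  \row_i 'D_(delta_mx 0 i : 'rV[R]_n) f x.

Definition class_C2 (U : set 'rV[R]_n) (f : 'rV[R]_n -> R) :=
  forall x, U x -> [/\ differentiable f x, differentiable (grad f) x &
                       {for x, continuous (jacobian (grad f))}].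

Definition C2_boundary K :=
  forall x, boundary K x -> exists (U : set 'rV[R]_n) (f : 'rV[R]_n -> R),
    [/\ open U, U x, class_C2 U f, forall y, U y -> grad f y != 0 &
        boundary K `&` U = [set y | f y = 0] `&` U].

Definition outer_normal K x u :=
  enorm u = 1 /\ forall y, K y -> dotp y u <= dotp x u.

Definition gauss_map K x : 'rV[R]_n := xget 0 [set u | outer_normal K x u].

(* W restricts on the tangent space at x to the Weingarten map, i.e. to the
   differential at x, along boundary K, of the Gauss map; it fixes the normal,
   so that its determinant is the one of the Weingarten map (matrices act on
   row vectors on the right). *)
Definition weingarten K x (W : 'M[R]_n) :=
  (fun y => gauss_map K y - gauss_map K x - (y - x) *m W)
    =o_ (within (boundary K) (nbhs x)) (fun y => y - x) /\
  gauss_map K x *m W = gauss_map K x.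

Definition gauss_curvature K x : R := \det (xget 0 [set W | weingarten K x W]).

Definition C2_plus K :=
  C2_boundary K /\ forall x, boundary K x -> 0 < gauss_curvature K x.

Definition normal_point K u : 'rV[R]_n :=
  xget 0 [set x | boundary K x /\ outer_normal K x u].

Definition curvature K u : R := gauss_curvature K (normal_point K u).

Definition centro_affine_curvature K u : R :=
  curvature K u / support K u ^+ n.+1.

Definition affine_area (q : R) K : R :=
  \int[sphere_measure]_(u in sphere R n)
    (centro_affine_curvature K u `^ (q / (n%:R + q)) *
     (support K u / curvature K u)).

Definition paouris_werner K : R :=
  lim ((affine_area q K / (n%:R * vol (polar K))) `^ (n%:R + q) @[q --> +oo]).

End convex_bodies.

(* Main.v *)
(* With e = 1/(n+q), the q-affine surface area is the exponential integral
   F(e) = int exp(- n e ln K_0) h^-n over the sphere. In polar coordinates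
   F(0) = n Vol(K^o), so both limits compare F(+-1/s) to F(0): as s tends to
   infinity, (F(1/s)/F(0))^s tends to exp(F'(0)/F(0)), while
   (F(-1/s)/F(0))^s, taken at s = 2^p, tends to exp(-F'(0)/F(0)).
   F is differentiable at 0 because ln K_0 is measurable and bounded, which comes
   from the Gauss map being a homeomorphism from the boundary onto the sphere:
   near a boundary point it is the normalized gradient of a defining function,
   its differential yields a continuous determinant, and positivity of the latter
   excludes two points with the same normal. *)
Require Import Defs.
From mathcomp Require Import all_boot all_order all_algebra.
From mathcomp Require Import all_classical all_reals all_analysis.
From mathcomp Require Import measurable_realfun ring lra.
Import Order.TTheory GRing.Theory Num.Theory.
Import numFieldNormedType.Exports.

Local Open Scope classical_set_scope.
Local Open Scope ring_scope.

(** * Continuity of matrix operations and the inner product *)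

(** [gauss_map], [gauss_curvature] and [normal_point] are choices made by [xget], so nothing is
    known of them before existence and uniqueness are settled. An outer normal is unique because it
    must be parallel to the gradient of a chart, a Weingarten matrix because the boundary leaves
    each of its points in every tangent direction, a point with given normal because the curvature
    does not vanish. The charts are mere zero sets, whose gradient may point inwards; since the
    origin is interior, the sign of its product with the position vector orients it. Compactness of
    the boundary then does two things: it bounds curvature and support function away from 0 and
    infinity, and it makes the Gauss map send closed sets to closed sets, which is all that
    measurability on the sphere requires. The spherical measure being defined by cones, polar
    coordinates are needed only for star-shaped sets, and only to evaluate the integral at e = 0. *)

Section matrix_continuity.
Context {R : realType} {T : topologicalType}.

Lemma continuous_sum (I : Type) (r : seq I)
    (F : I -> T -> R) x : (forall i, {for x, continuous (F i)}) ->
  {for x, continuous (fun y => \sum_(i <- r) F i y)}.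
Proof.
move=> Fx; elim: r => [|i r IH].
  rewrite (_ : (fun y => _) = cst 0); first exact: cvg_cst.
  by apply/funext => y; rewrite big_nil.
rewrite (_ : (fun y => _) = F i \+ (fun y => \sum_(j <- r) F j y)).
  by apply: cvgD => //; exact: Fx.
by apply/funext => y; rewrite big_cons.
Qed.

Lemma continuous_coef m n (A : T -> 'M[R]_(m, n)) x i j :
  {for x, continuous A} -> {for x, continuous (fun y => A y i j)}.
Proof.
move=> Ax; apply: (@continuous_comp _ _ _ A (fun M : 'M[R]_(m, n) => M i j)) => //.
exact: coord_continuous.
Qed.

Lemma continuous_mx m n (A : T -> 'M[R]_(m, n)) x :
  (forall i j, {for x, continuous (fun y => A y i j)}) -> {for x, continuous A}.
Proof.
move=> Ax; apply/cvgrPdist_lt => e e0.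
have : \forall y \near x, forall i j, `|A x i j - A y i j| < e.
  apply: filter_forall => i; apply: filter_forall => j.
  by have /cvgrPdist_lt/(_ e e0) := Ax i j.
apply: filterS => y ye.
rewrite [ltLHS]/Num.norm/= mx_normrE; apply/bigmax_ltP; split => //= -[i j] _ /=.
by rewrite !mxE.
Qed.

Lemma continuous_mulmx m n p (A : T -> 'M[R]_(m, n)) (B : T -> 'M[R]_(n, p)) x :
  {for x, continuous A} -> {for x, continuous B} ->
  {for x, continuous (fun y => A y *m B y)}.
Proof.
move=> Ax Bx; apply: continuous_mx => i j.
rewrite (_ : (fun y => _) = fun y => \sum_k A y i k * B y k j); last first.
  by apply/funext => y; rewrite mxE.
by apply: continuous_sum => k; apply: cvgM; exact: continuous_coef.
Qed.

Lemma continuous_trmx m n (A : T -> 'M[R]_(m, n)) x :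
  {for x, continuous A} -> {for x, continuous (fun y => (A y)^T)}.
Proof.
move=> Ax; apply: continuous_mx => i j.
rewrite (_ : (fun y => _) = fun y => A y j i); last first.
  by apply/funext => y; rewrite mxE.
exact: continuous_coef.
Qed.

Lemma continuous_prod (I : Type) (r : seq I) (F : I -> T -> R) x :
  (forall i, {for x, continuous (F i)}) ->
  {for x, continuous (fun y => \prod_(i <- r) F i y)}.
Proof.
move=> Fx; elim: r => [|i r IH].
  rewrite (_ : (fun y => _) = cst 1); first exact: cvg_cst.
  by apply/funext => y; rewrite big_nil.
rewrite (_ : (fun y => _) = F i \* (fun y => \prod_(j <- r) F j y)).
  by apply: cvgM => //; exact: Fx.
by apply/funext => y; rewrite big_cons.
Qed.

Lemma continuous_det n (A : T -> 'M[R]_n) x :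
  {for x, continuous A} -> {for x, continuous (fun y => \det (A y))}.
Proof.
move=> Ax; rewrite /determinant; apply: continuous_sum => s.
apply: cvgM; first exact: cvg_cst.
by apply: continuous_prod => i; exact: continuous_coef.
Qed.

End matrix_continuity.

Section dotp_theory.
Context {R : realType} {n : nat}.
Implicit Types (u v w : 'rV[R]_n) (a : R).

Lemma dotpE u v : dotp u v = (u *m v^T) 0 0.
Proof. by rewrite mxE; apply: eq_bigr => i _; rewrite mxE. Qed.

Lemma dotpC u v : dotp u v = dotp v u.
Proof. by apply: eq_bigr => i _; rewrite mulrC. Qed.

Lemma dotpDl u v w : dotp (u + v) w = dotp u w + dotp v w.
Proof. by rewrite !dotpE mulmxDl mxE. Qed.

Lemma dotpZl a u v : dotp (a *: u) v = a * dotp u v.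
Proof. by rewrite !dotpE -scalemxAl mxE. Qed.

Lemma dotpNl u v : dotp (- u) v = - dotp u v.
Proof. by rewrite -scaleN1r dotpZl mulN1r. Qed.

Lemma dotpBl u v w : dotp (u - v) w = dotp u w - dotp v w.
Proof. by rewrite dotpDl dotpNl. Qed.

Lemma dotpDr u v w : dotp u (v + w) = dotp u v + dotp u w.
Proof. by rewrite dotpC dotpDl !(dotpC u). Qed.

Lemma dotpZr a u v : dotp u (a *: v) = a * dotp u v.
Proof. by rewrite dotpC dotpZl dotpC. Qed.

Lemma dotpNr u v : dotp u (- v) = - dotp u v.
Proof. by rewrite dotpC dotpNl dotpC. Qed.

Lemma dotpBr u v w : dotp u (v - w) = dotp u v - dotp u w.
Proof. by rewrite dotpDr dotpNr. Qed.

Lemma dotp0l u : dotp 0 u = 0.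
Proof. by rewrite dotpE mul0mx mxE. Qed.

Lemma dotp_ge0 u : 0 <= dotp u u.
Proof. by apply: sumr_ge0 => i _; rewrite -expr2 sqr_ge0. Qed.

Lemma dotp_gt0 u : (0 < dotp u u) = (u != 0).
Proof.
rewrite lt0r dotp_ge0 andbT; congr (~~ _).
apply/idP/eqP => [|->]; last by rewrite dotp0l.
rewrite psumr_eq0 => [/allP u0|i _]; last by rewrite -expr2 sqr_ge0.
apply/rowP => i; rewrite mxE; apply/eqP.
by have := u0 i (mem_index_enum _); rewrite mulf_eq0 orbb.
Qed.

Lemma enorm_ge0 u : 0 <= enorm u.
Proof. exact: sqrtr_ge0. Qed.

Lemma sqr_enorm u : enorm u ^+ 2 = dotp u u.
Proof. by rewrite sqr_sqrtr// dotp_ge0. Qed.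

Lemma enorm_gt0 u : (0 < enorm u) = (u != 0).
Proof. by rewrite sqrtr_gt0 dotp_gt0. Qed.

Lemma enormZ a u : enorm (a *: u) = `|a| * enorm u.
Proof.
by rewrite /enorm dotpZl dotpZr mulrA -expr2 sqrtrM ?sqr_ge0// sqrtr_sqr.
Qed.

Lemma enorm1_dotp u : enorm u = 1 <-> dotp u u = 1.
Proof.
split=> [u1|]; first by rewrite -sqr_enorm u1 expr1n.
by rewrite /enorm => ->; rewrite sqrtr1.
Qed.

Lemma enorm1_neq0 u : enorm u = 1 -> u != 0.
Proof. by move=> u1; rewrite -enorm_gt0 u1. Qed.

Lemma enorm_normalize u : u != 0 -> enorm (normalize u) = 1.
Proof.
rewrite -enorm_gt0 => u0.
by rewrite enormZ ger0_norm ?invr_ge0 ?ltW// mulVf// gt_eqF.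
Qed.

Lemma normalizeZ a u : 0 < a -> normalize (a *: u) = normalize u.
Proof.
move=> a0; rewrite /normalize enormZ gtr0_norm// invfM scalerA mulrAC.
by rewrite mulVf ?gt_eqF// mul1r.
Qed.

Lemma le_coord_norm u i : `|u 0 i| <= `|u|.
Proof.
rewrite [leRHS]/Num.norm/= mx_normrE; apply/bigmax_geP; right => /=.
by exists (0, i).
Qed.

Lemma le_norm_enorm u : `|u| <= enorm u.
Proof.
rewrite [leLHS]/Num.norm/= mx_normrE; apply/bigmax_leP; split => /= [|[j i] _].
  exact: enorm_ge0.
rewrite (ord1 j)/= -ler_sqr ?nnegrE ?enorm_ge0// sqr_enorm real_normK ?num_real//.
rewrite /dotp (bigD1 i)//= -expr2 lerDl; apply: sumr_ge0 => k _.
by rewrite -expr2 sqr_ge0.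
Qed.

Lemma continuous_dotp (T : topologicalType) (f g : T -> 'rV[R]_n) x :
  {for x, continuous f} -> {for x, continuous g} ->
  {for x, continuous (fun y => dotp (f y) (g y))}.
Proof.
move=> fx gx; rewrite /dotp; apply: continuous_sum => i.
by apply: cvgM; exact: continuous_coef.
Qed.

Lemma continuous_enorm (T : topologicalType) (f : T -> 'rV[R]_n) x :
  {for x, continuous f} -> {for x, continuous (fun y => enorm (f y))}.
Proof.
move=> fx; apply: (@continuous_comp _ _ _ (fun y => dotp (f y) (f y)) Num.sqrt).
  exact: continuous_dotp.
exact: sqrt_continuous.
Qed.


Lemma derive_grad (f : 'rV[R]_n -> R) x v :
  differentiable f x -> 'D_v f x = dotp v (grad f x).
Proof.
move=> df; rewrite deriveE// {1}[v]row_sum_delta linear_sum.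
by apply: eq_bigr => i _; rewrite linearZ/= mxE deriveE.
Qed.

End dotp_theory.

(** * Level sets and convex sets *)

Section level_set.
Context {R : realType} {n : nat}.
Implicit Types (f : 'rV[R]_n -> R) (U : set 'rV[R]_n) (y w : 'rV[R]_n).

Let cvg_slope f y w : differentiable f y -> f y = 0 ->
  h^-1 * f (y + h *: w) @[h --> 0^'+] --> dotp w (grad f y).
Proof.
move=> df fy0; apply: cvg_dnbhs_at_right.
have : h^-1 *: (f (h *: w + y) - f y) @[h --> 0^'] --> dotp w (grad f y).
  by rewrite -derive_grad//; exact: (diff_derivable df).
by rewrite fy0; under eq_cvg do rewrite subr0 addrC.
Qed.

Lemma grad_gt0_near f y w : differentiable f y -> f y = 0 ->
  0 < dotp w (grad f y) -> \forall t \near 0^'+, 0 < f (y + t *: w).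
Proof.
move=> df fy0 wg; have /cvgr_gt/(_ _ wg) nearw := cvg_slope _ _ w df fy0.
near=> t; have t0 : 0 < t by [].
suff : 0 < t^-1 * f (y + t *: w) by rewrite pmulr_rgt0// invr_gt0.
by near: t.
Unshelve. all: by end_near. Qed.

Lemma grad_lt0_near f y w : differentiable f y -> f y = 0 ->
  dotp w (grad f y) < 0 -> \forall t \near 0^'+, f (y + t *: w) < 0.
Proof.
move=> df fy0 wg; have /cvgr_lt/(_ _ wg) nearw := cvg_slope _ _ w df fy0.
near=> t; have t0 : 0 < t by [].
suff : t^-1 * f (y + t *: w) < 0 by rewrite pmulr_rlt0// invr_gt0.
by near: t.
Unshelve. all: by end_near. Qed.

(* By the intermediate value theorem on a segment: this stands in for the
   implicit function theorem throughout. *)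
Lemma grad_crossing f U y w w' : open U -> U y ->
  (forall z, U z -> differentiable f z) -> f y = 0 ->
  0 < dotp w (grad f y) -> dotp w' (grad f y) < 0 ->
  \forall t \near 0^'+, exists2 l, 0 <= l <= 1 &
    U (y + t *: (l *: w + (1 - l) *: w')) /\
    f (y + t *: (l *: w + (1 - l) *: w')) = 0.
Proof.
move=> oU Uy df fy0 wg wg'.
have [e /= e0 eU] : nbhs_ball y U by apply/nbhs_ballP; exact: open_nbhs_nbhs.
(* This bounds the norm of every convex combination of [w] and [w'], so a small multiple of it keeps
   the whole segment inside [U]. *)
have M0 : 0 < `|w| + `|w'| + 1 by rewrite ltr_wpDl// addr_ge0.
have dfy := df _ Uy; near=> t; have t0 : 0 < t by [].
have fw : 0 < f (y + t *: w) by near: t; exact: grad_gt0_near.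
have fw' : f (y + t *: w') < 0 by near: t; exact: grad_lt0_near.
have te : t * (`|w| + `|w'| + 1) < e.
  rewrite -ltr_pdivlMr//; near: t; apply: nbhs_right_lt; exact: divr_gt0.
have Uz l : 0 <= l <= 1 -> U (y + t *: (l *: w + (1 - l) *: w')).
  move=> /andP[l0 l1]; apply: eU; rewrite -ball_normE/=.
  rewrite opprD addrA subrr sub0r normrN normrZ gtr0_norm//.
  apply: le_lt_trans te; rewrite ler_pM2l// (le_trans (ler_normD _ _))//.
  rewrite !normrZ !ger0_norm ?subr_ge0// -addrA; apply: lerD.
    by rewrite ler_piMl.
  by rewrite ler_wpDr// ler_piMl// gerBl.
pose phi l := f (y + t *: (l *: w + (1 - l) *: w')).
have [l l01 fl] : exists2 l, l \in `[0, 1]%R & phi l = 0.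
  apply: IVT => //; last first.
    rewrite /phi !subr0 !subrr !scale0r !scale1r addr0 add0r.
    by rewrite ge_min le_max (ltW fw) (ltW fw') orbT.
  apply: continuous_in_subspaceT => l /set_mem /=; rewrite in_itv/= => l01.
  rewrite /phi; apply: (@continuous_comp _ _ _
    (fun l : R => y + t *: (l *: w + (1 - l) *: w')) f).
    apply: cvgD; first exact: cvg_cst.
    apply: cvgZr; apply: cvgD; apply: cvgZl; first exact: cvg_id.
    by apply: cvgB; [exact: cvg_cst|exact: cvg_id].
  exact/differentiable_continuous/df/Uz.
by rewrite in_itv in l01; exists l => //; split => //; exact: Uz.
Unshelve. all: by end_near. Qed.

End level_set.

Section convex.
Context {R : realType} {n : nat}.
Implicit Types (K U : set 'rV[R]_n) (x y z w : 'rV[R]_n) (t : R).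

Lemma convex_setP K x y t : convex_set K -> K x -> K y -> 0 <= t <= 1 ->
  K (t *: x + (1 - t) *: y).
Proof.
move=> cK Kx Ky /andP[t0 t1].
by have := cK x y (Itv01 t0 t1); rewrite !inE; exact.
Qed.

(** The homothety with centre [y] and ratio [t] maps a ball of radius [e] around [z] inside [K] to a
    ball of radius [t * e] inside [K]. *)
Lemma interior_conv K y z t : convex_set K -> K y -> K° z -> 0 < t <= 1 ->
  K° ((1 - t) *: y + t *: z).
Proof.
move=> cK Ky /nbhs_ballP[e /= e0 zeK] /andP[t0 t1].
apply/nbhs_ballP; exists (t * e) => /=; first exact: mulr_gt0.
move=> w; rewrite -ball_normE/= => we.
rewrite (_ : w = t *: (z + t^-1 *: (w - ((1 - t) *: y + t *: z))) + (1 - t) *: y).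
  apply: convex_setP => //; last by rewrite (ltW t0).
  apply: zeK; rewrite -ball_normE/= opprD addrA subrr sub0r normrN normrZ.
  by rewrite gtr0_norm ?invr_gt0// mulrC ltr_pdivrMr// distrC mulrC.
by apply/rowP => i; rewrite !mxE; field; rewrite gt_eqF.
Qed.

Lemma convex_interior K y z t : convex_set K -> K° y -> K° z -> 0 <= t <= 1 ->
  K° ((1 - t) *: y + t *: z).
Proof.
move=> cK Ky Kz /andP[]; rewrite le_eqVlt => /predU1P[<- _|t0 t1].
  by rewrite subr0 scale1r scale0r addr0.
by apply: interior_conv => //; [exact: interior_subset|rewrite t0].
Qed.

End convex.

(** * Outer normals of a convex body with differentiable boundary *)

Definition C2_chart {R : realType} {n : nat} (K U : set 'rV[R]_n)
    (f : 'rV[R]_n -> R) :=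
  [/\ open U, class_C2 U f, forall y, U y -> grad f y != 0 &
      boundary K `&` U = [set y | f y = 0] `&` U].

(* The sign makes the angle with the position vector acute: the origin being
   interior, this is the outward unit normal of the level set. *)
Definition unit_grad {R : realType} {n : nat} (f : 'rV[R]_n -> R) y : 'rV[R]_n :=
  (Num.sg (dotp y (grad f y)) / enorm (grad f y)) *: grad f y.

Section outer_normals.
Context {R : realType} {n : nat} (K : set 'rV[R]_n).
Hypotheses (cbK : convex_body K) (K0 : K° 0).
Implicit Types (x y z u : 'rV[R]_n).

Let clK : closed K.
Proof. by case: cbK => cK _ _; apply: compact_closed => //; exact: norm_hausdorff. Qed.

Let cK : convex_set K. Proof. by case: cbK. Qed.

Lemma boundaryE : boundary K = K `\` K°.
Proof. by rewrite /boundary -(closure_id K).1. Qed.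

Lemma compact_boundary : compact (boundary K).
Proof.
rewrite boundaryE setDE; apply: compact_closedI; first by case: cbK.
by apply: open_closedC; exact: open_interior.
Qed.

(** The origin being interior, [K] contains a small positive multiple of [u], and [x] does at least
    as well as that point. *)
Lemma outer_normal_gt0 x u : outer_normal K x u -> 0 < dotp x u.
Proof.
move=> [u1 /(_ _) xu]; have u0 := enorm1_neq0 _ u1.
have [e /= e0 eK] : nbhs_ball (0 : 'rV[R]_n) K by exact/nbhs_ballP.
have nu0 : 0 < `|u| by rewrite normr_gt0.
apply: lt_le_trans (xu ((e / 2 / `|u|) *: u) _).
  by rewrite dotpZl (enorm1_dotp _).1// mulr1 !divr_gt0.
apply: eK; rewrite -ball_normE/= sub0r normrN normrZ ger0_norm; last first.
  by rewrite !divr_ge0// ltW.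
by rewrite divfK ?gt_eqF// ltr_pdivrMr// ltr_pMr// ltr1n.
Qed.

Section chart.
Context (U : set 'rV[R]_n) (f : 'rV[R]_n -> R) (y : 'rV[R]_n).
Hypotheses (KUf : C2_chart K U f) (bKy : boundary K y) (Uy : U y).

Let g := grad f y.

Let df z : U z -> differentiable f z.
Proof. by case: KUf => _ C2 _ _ /C2[]. Qed.

Let g0 : g != 0. Proof. by case: KUf => _ _ /(_ _ Uy). Qed.

Let gg0 : 0 < dotp g g. Proof. by rewrite dotp_gt0. Qed.

Let chartP z : U z -> boundary K z <-> f z = 0.
Proof.
case: KUf => _ _ _ /seteqP[KUf1 KUf2] Uz.
by split=> [bz|fz]; [case: (KUf1 z)|case: (KUf2 z)].
Qed.

Let Ky : K y. Proof. by move: bKy; rewrite boundaryE => -[]. Qed.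

(** Used three times: to forbid a change of sign of the gradient on the interior, then in front of
    an outer normal, and to find boundary points close to any tangent direction. *)
Lemma boundary_crossing w w' : 0 < dotp w g -> dotp w' g < 0 ->
  \forall t \near 0^'+, exists2 l, 0 <= l <= 1 &
    boundary K (y + t *: (l *: w + (1 - l) *: w')).
Proof.
move=> wg w'g; case: (KUf) => oU _ _ _.
have := grad_crossing f U y w w' oU Uy df ((chartP _ Uy).1 bKy) wg w'g.
by apply: filterS => t [l l01 [Ul fl]]; exists l => //; exact/chartP.
Qed.

(* Otherwise the level set would meet the interior, along the segment joining
   the directions towards z and z'. *)
Let interior_side z z' : K° z -> K° z' ->
  0 < dotp (z - y) g -> dotp (z' - y) g < 0 -> False.
Proof.
move=> Kz Kz' zg z'g; have near_bd := boundary_crossing _ _ zg z'g.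
have near_le1 : \forall t \near (0:R)^'+, t <= 1 by exact: nbhs_right_le.
near (0:R)^'+ => t; have t0 : 0 < t by [].
have [l l01] : exists2 l, 0 <= l <= 1 &
    boundary K (y + t *: (l *: (z - y) + (1 - l) *: (z' - y))).
  by near: t.
rewrite boundaryE => -[_]; apply.
rewrite (_ : y + _ = (1 - t) *: y + t *: ((1 - l) *: z' + l *: z)).
  apply: interior_conv cK Ky _ _; first exact: convex_interior cK Kz' Kz l01.
  by rewrite t0/=; near: t.
by apply/rowP => i; rewrite !mxE; ring.
Unshelve. all: by end_near. Qed.

Let interior_perturb z : K° z -> exists2 e, 0 < e & K° (z + e *: g) /\ K° (z - e *: g).
Proof.
move=> Kz; have [e /= e0 eK] : nbhs_ball z (K°).
  by apply/nbhs_ballP/open_nbhs_nbhs; split => //; exact: open_interior.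
have ng0 : 0 < `|g| by rewrite normr_gt0.
have H : `|(e / 2 / `|g|) *: g| < e.
  rewrite normrZ ger0_norm; last by rewrite !divr_ge0// ltW.
  by rewrite divfK ?gt_eqF// ltr_pdivrMr// ltr_pMr// ltr1n.
exists (e / 2 / `|g|); first by rewrite !divr_gt0.
split; apply: eK; rewrite -ball_normE/=.
  by rewrite opprD addrA subrr sub0r normrN.
by rewrite opprB addrCA subrr addr0.
Qed.

(** If [z - y] were orthogonal to [g], moving [z] slightly along [g] and [- g] would give interior
    points on both sides of the tangent plane. *)
Let interior_neq0 z : K° z -> dotp (z - y) g != 0.
Proof.
move=> Kz; apply/eqP => zg; have [e e0 [Kz1 Kz2]] := interior_perturb _ Kz.
apply: (interior_side _ _ Kz1 Kz2); rewrite addrAC dotpDl zg add0r.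
  by rewrite dotpZl mulr_gt0.
by rewrite dotpNl dotpZl oppr_lt0 mulr_gt0.
Qed.

Let s := Num.sg (dotp y g).

(** The interior lies strictly on the side of the tangent plane that contains the origin;
    multiplying by [s] treats both orientations of [g] at once. *)
Let interior_sg z : K° z -> s * dotp z g < s * dotp y g.
Proof.
move=> Kz; rewrite -subr_lt0 -mulrBr -dotpBl.
have := interior_neq0 _ K0; rewrite sub0r dotpNl oppr_eq0 => yg0.
have := interior_neq0 _ Kz; have [zg|zg|//] := ltgtP (dotp (z - y) g) 0; rewrite /s => _.
- move: yg0; have [yg|yg|//] := ltgtP (dotp y g) 0 => _; last by rewrite gtr0_sg// mul1r.
  by exfalso; apply: (interior_side _ _ K0 Kz) => //; rewrite sub0r dotpNl oppr_gt0.
- move: yg0; have [yg|yg|//] := ltgtP (dotp y g) 0 => _.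
    by rewrite ltr0_sg// mulN1r oppr_lt0.
  by exfalso; apply: (interior_side _ _ Kz K0) => //; rewrite sub0r dotpNl oppr_lt0.
Qed.

Lemma dotp_grad_neq0 : dotp y g != 0.
Proof. by have := interior_neq0 _ K0; rewrite sub0r dotpNl oppr_eq0. Qed.

Let dotp_unit_grad z : dotp z (unit_grad f y) = (enorm g)^-1 * (s * dotp z g).
Proof. by rewrite dotpZr -/g -/s; ring. Qed.

Let eg0 : 0 < enorm g. Proof. by rewrite enorm_gt0. Qed.

Let enorm_unit_grad : enorm (unit_grad f y) = 1.
Proof.
rewrite enormZ normrM normrV ?unitfE ?gt_eqF// (ger0_norm (ltW eg0)).
by rewrite normr_sg dotp_grad_neq0 mul1r mulVf// gt_eqF.
Qed.

Lemma outer_normal_unit_grad : outer_normal K y (unit_grad f y).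
Proof.
split; first exact: enorm_unit_grad.
move=> z Kz; rewrite !dotp_unit_grad ler_pM2l ?invr_gt0//.
rewrite leNgt; apply/negP => yz.
have yg0 : 0 < s * dotp y g by rewrite -normrEsg normr_gt0 dotp_grad_neq0.
(* The point [(b / a) *: z], strictly between the origin and [z], is interior, yet takes the same
   value as [y], against the strict inequality [interior_sg]. *)
pose a := s * dotp z g; pose b := s * dotp y g.
have a0 : 0 < a := lt_trans yg0 yz.
have /interior_sg : K° ((1 - (1 - b / a)) *: z + (1 - b / a) *: 0).
  apply: interior_conv => //; rewrite subr_gt0 ltr_pdivrMr// mul1r yz/=.
  by rewrite gerBl divr_ge0// ltW.
by rewrite scaler0 addr0 subKr dotpZl mulrCA divfK ?ltxx// gt_eqF.
Qed.

(* The half-space in front of an outer normal u misses K, so the gradient may not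
   change sign on it; this forces u to be parallel to the gradient. *)
Lemma outer_normalE u : outer_normal K y u -> u = unit_grad f y.
Proof.
move=> yu; have [u1 Ku] := yu; have uu1 := (enorm1_dotp _).1 u1.
have one_side w w' : 0 < dotp w u -> 0 < dotp w' u -> 0 < dotp w g ->
    dotp w' g < 0 -> False.
  move=> wu w'u wg w'g; have near_bd := boundary_crossing _ _ wg w'g.
  near (0:R)^'+ => t; have t0 : 0 < t by [].
  have [l /andP[l0 l1]] : exists2 l, 0 <= l <= 1 &
      boundary K (y + t *: (l *: w + (1 - l) *: w')) by near: t.
  rewrite boundaryE => -[/Ku + _].
  rewrite dotpDl gerDl dotpZl pmulr_rle0// dotpDl !dotpZl leNgt => /negP; apply.
  move: l0; rewrite le_eqVlt => /predU1P[<-|l0]; first by rewrite mul0r add0r subr0 mul1r.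
  by apply: ltr_pwDl; [exact: mulr_gt0|rewrite mulr_ge0 ?subr_ge0// ltW].
pose tau := g - dotp g u *: u.
have tauu : dotp tau u = 0 by rewrite dotpBl dotpZl uu1 mulr1 subrr.
have taug : dotp tau g = dotp tau tau.
  by rewrite [in RHS]/tau dotpBr dotpZr tauu mulr0 subr0.
have tau0 : tau = 0.
  apply/eqP/negPn/negP; rewrite -dotp_gt0 => tt0.
  (* With this factor the tangential part outweighs [dotp u g], so the gradient takes both signs on
     directions that have product 1 with [u]. *)
  pose M := (`|dotp u g| + 1) / dotp tau tau.
  have Mt : M * dotp tau tau = `|dotp u g| + 1 by rewrite divfK// gt_eqF.
  apply: (one_side (u + M *: tau) (u - M *: tau)).
  - by rewrite dotpDl uu1 dotpZl tauu mulr0 addr0.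
  - by rewrite dotpBl uu1 dotpZl tauu mulr0 subr0.
  - rewrite dotpDl dotpZl taug Mt; have := ler_norm (- dotp u g); rewrite normrN; lra.
  - rewrite dotpBl dotpZl taug Mt; have := ler_norm (dotp u g); lra.
have [c gu c0] : exists2 c, g = c *: u & c != 0.
  have gu : g = dotp g u *: u by apply/eqP; rewrite -subr_eq0 -/tau tau0.
  by exists (dotp g u) => //; apply: contra g0 => /eqP gu0; rewrite gu gu0 scale0r.
have yu0 := outer_normal_gt0 _ _ yu.
rewrite /unit_grad -/g gu enormZ u1 mulr1 dotpZr sgrM (gtr0_sg yu0) mulr1.
by rewrite scalerA -mulrA [_^-1 * _]mulrC mulrA -normrEsg divff ?scale1r// normr_eq0.
Unshelve. all: by end_near. Qed.

Lemma gauss_map_unit_grad : gauss_map K y = unit_grad f y.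
Proof.
apply: outer_normalE; have := @xgetPex _ 0 [set u | outer_normal K y u].
by apply; exists (unit_grad f y); exact: outer_normal_unit_grad.
Qed.

End chart.

End outer_normals.

(** * The unit normal field of a level set *)

Lemma near_eq_continuous_at {T U : topologicalType} {f g : T -> U} {x : T} :
  (\forall y \near x, f y = g y) -> {for x, continuous g} ->
  {for x, continuous f}.
Proof.
move=> fg gx; rewrite /prop_for /continuous_at (nbhs_singleton fg).
apply: cvg_trans gx; apply: near_eq_cvg.
by apply: filterS fg => y ->.
Qed.

Lemma diff_near {R : realType} {V W : normedModType R} (f : V -> W) x (e : R) :
  differentiable f x -> 0 < e ->
  \forall y \near x, `|f y - f x - 'd f x (y - x)| <= e * `|y - x|.
Proof.
move=> df e0; have /eqaddoP/(_ _ e0) := diff_locally df.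
rewrite [in X in _ -> X](near_shift 0); apply: filterS => h /=.
by rewrite !fctE /shift/= subr0 addrK opprD addrA.
Qed.

Section unit_gradient.
Context {R : realType} {n : nat} (U : set 'rV[R]_n) (f : 'rV[R]_n -> R).
Context (x : 'rV[R]_n).
Hypotheses (C2f : class_C2 U f) (Ux : U x) (xg0 : dotp x (grad f x) != 0).

Let g := grad f.

Let g0 : g x != 0.
Proof. by apply: contra xg0 => /eqP; rewrite -/g => ->; rewrite dotpC dotp0l. Qed.

Let eg0 : 0 < enorm (g x). Proof. by rewrite enorm_gt0. Qed.

Let dg : differentiable g x. Proof. by have [] := C2f _ Ux. Qed.

Let cg : {for x, continuous g}. Proof. exact: differentiable_continuous. Qed.

Let cJ : {for x, continuous (jacobian g)}. Proof. by have [] := C2f _ Ux. Qed.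

Let cxg : {for x, continuous (fun y => dotp y (g y))}.
Proof. exact: (@continuous_dotp R n _ id g x (@cvg_id _ _) cg). Qed.

(** A nonzero sign is locally constant, so it can be frozen at [x]; the remaining factor [k] of the
    gradient is then differentiable. *)
Lemma sg_grad_near :
  \forall y \near x, Num.sg (dotp y (grad f y)) = Num.sg (dotp x (grad f x)).
Proof.
have [xg|xg|xg] := ltgtP (dotp x (g x)) 0.
- have /cvgr_lt/(_ _ xg) := cxg; apply: filterS => y yg.
  by rewrite !ltr0_sg.
- have /cvgr_gt/(_ _ xg) := cxg; apply: filterS => y yg.
  by rewrite !gtr0_sg.
- by move: xg0; rewrite -/g xg eqxx.
Qed.

Let k y := Num.sg (dotp x (g x)) / enorm (g y).

Lemma unit_grad_near : \forall y \near x, unit_grad f y = k y *: grad f y.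
Proof. by apply: filterS sg_grad_near => y; rewrite /unit_grad => ->. Qed.

Let ck : {for x, continuous k}.
Proof.
apply: (@cvgM _ _ (nbhs x) _ (cst (Num.sg (dotp x (g x))))); first exact: cvg_cst.
by apply: cvgV; [rewrite gt_eqF|exact: continuous_enorm].
Qed.

Lemma continuous_unit_grad : {for x, continuous (unit_grad f)}.
Proof.
apply: (near_eq_continuous_at unit_grad_near).
exact: (@cvgZ _ _ _ (nbhs x) _ k g _ _ ck cg).
Qed.


Let G j y := g y 0 j.

Let dG j : differentiable (G j) x.
Proof.
apply: (@differentiable_comp _ _ _ _ g (fun v : 'rV[R]_n => v 0 j)) => //.
exact: differentiable_coord.
Qed.

Let DG h j : 'D_h (G j) x = (h *m jacobian g x) 0 j.
Proof.
by rewrite -deriveEjacobian// derive_mx ?mxE//; exact: diff_derivable.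
Qed.

Let qE : (fun y => dotp (g y) (g y)) = \sum_(j < n) (G j * G j).
Proof. by apply/funext => y; rewrite fct_sumE. Qed.

Let dq : differentiable (fun y => dotp (g y) (g y)) x.
Proof. by rewrite qE; apply: differentiable_sum => j; exact: differentiableM. Qed.

Let Dq h : 'D_h (fun y => dotp (g y) (g y)) x =
  2 * dotp (h *m jacobian g x) (g x).
Proof.
rewrite qE derive_sum => [|j]; last exact/diff_derivable/differentiableM.
rewrite mulr_sumr; apply: eq_bigr => j _.
rewrite deriveM; [|exact: diff_derivable..].
by rewrite DG -mulr2n -mulr_natl mulrC /GRing.scale/= /G; ring.
Qed.

Let sqrtE : (fun y => enorm (g y)) = Num.sqrt \o (fun y => dotp (g y) (g y)).
Proof. by []. Qed.

Let dsqrt : differentiable (Num.sqrt : R -> R) (dotp (g x) (g x)).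
Proof.
apply/derivable1_diffP; have [] := @is_derive1_sqrt R (dotp (g x) (g x)) => //.
by rewrite dotp_gt0.
Qed.

Let denorm : differentiable (fun y => enorm (g y)) x.
Proof. by rewrite sqrtE; exact: differentiable_comp. Qed.

Let Denorm h : 'D_h (fun y => enorm (g y)) x =
  (enorm (g x))^-1 * dotp (h *m jacobian g x) (g x).
Proof.
rewrite deriveE// sqrtE diff_comp//= diff1E//= -deriveE// Dq derive1E.
have [_ ->] := @is_derive1_sqrt R (dotp (g x) (g x)) ltac:(by rewrite dotp_gt0).
by rewrite /GRing.scale/= -/(enorm (g x)) invfM; field; rewrite gt_eqF.
Qed.

Let dk : differentiable k x.
Proof.
apply: differentiableM; first exact: differentiable_cst.
by apply: differentiableV => //; rewrite gt_eqF.
Qed.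

Let Dk h : 'D_h k x = - k x * dotp (h *m jacobian g x) (g x) / dotp (g x) (g x).
Proof.
have dV : derivable (fun y => (enorm (g y))^-1) x h.
  by apply: derivableV; [rewrite gt_eqF|exact: diff_derivable].
rewrite (deriveM (derivable_cst _ _ _) dV) derive_cst scaler0 addr0.
rewrite deriveV; [|by rewrite gt_eqF|exact: diff_derivable].
rewrite Denorm -sqr_enorm /GRing.scale/= /k.
by field; rewrite gt_eqF.
Qed.

(** The transposed Jacobian of the unit normal field, for row vectors: differentiating the
    normalized gradient gives the Hessian over the length of the gradient, followed by the
    projection orthogonal to the normal. *)
Definition shape_mx y : 'M[R]_n := let nu := unit_grad f y in
  (Num.sg (dotp y (grad f y)) / enorm (grad f y)) *:
    (jacobian (grad f) y *m (1%:M - nu^T *m nu)).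

Lemma continuous_shape_mx : {for x, continuous shape_mx}.
Proof.
pose A y := k y *: (jacobian g y *m (1%:M - (unit_grad f y)^T *m unit_grad f y)).
apply: (@near_eq_continuous_at _ _ _ A).
  by apply: filterS sg_grad_near => y; rewrite /shape_mx => ->.
apply: (@cvgZ _ _ _ (nbhs x) _ k _ _ _ ck).
have cnu := continuous_unit_grad.
have cnn : {for x, continuous (fun y => (unit_grad f y)^T *m unit_grad f y)}.
  exact: (@continuous_mulmx _ _ _ _ _ (fun y => (unit_grad f y)^T) (unit_grad f)
    x (continuous_trmx _ _ _ _ cnu) cnu).
have cpi : {for x, continuous (fun y => 1%:M - (unit_grad f y)^T *m unit_grad f y)}.
  apply: (@cvgB _ _ _ (nbhs x) _ (cst 1%:M)); last exact: cnn.
  exact: cvg_cst.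
exact: (@continuous_mulmx _ _ _ _ _ (jacobian g)
  (fun y => 1%:M - (unit_grad f y)^T *m unit_grad f y) x cJ cpi).
Qed.

Lemma unit_grad_expansion e : 0 < e -> \forall y \near x,
  `|unit_grad f y - unit_grad f x - (y - x) *m shape_mx x| <= e * `|y - x|.
Proof.
move=> e0.
pose N i := k * G i : 'rV[R]_n -> R.
have dN i : differentiable (N i) x by exact: differentiableM.
have DN h i : 'd (N i) x h = (h *m shape_mx x) 0 i.
  rewrite -deriveE// deriveM; [|exact: diff_derivable..].
  have projE (p v : 'rV[R]_n) (c : R) : (p *m (1%:M - (c *: v)^T *m (c *: v))) 0 i =
      p 0 i - c ^+ 2 * dotp p v * v 0 i.
    rewrite mulmxBr mulmx1 mulmxA !mxE big_ord1 !mxE dotpE !mxE mulr_sumr.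
    rewrite !mulr_suml; congr (_ - _); apply: eq_bigr => j _; rewrite !mxE; ring.
  rewrite DG Dk /shape_mx/= -/g -/(k x) -scalemxAr mulmxA.
  rewrite (nbhs_singleton unit_grad_near) -/g [RHS]mxE projE /GRing.scale/= /G.
  (* The derivative of the inverse norm brings a factor [(dotp (g x) (g x))^-1], the projection a
     factor [k x ^+ 2]; this identifies them. *)
  have k2 : k x ^+ 2 = (dotp (g x) (g x))^-1.
    by rewrite /k exprMn sqr_sg xg0 mul1r exprVn sqr_enorm.
  by rewrite -k2; ring.
have near_N : \forall y \near x, forall i,
    `|N i y - N i x - 'd (N i) x (y - x)| <= e * `|y - x|.
  apply: (@filter_forall _ _ (fun i y => _ <= _) (nbhs x)) => i.
  exact: (@diff_near _ _ _ (N i) x e (dN i) e0).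
apply: filterS2 unit_grad_near near_N => y -> Ny.
rewrite (nbhs_singleton unit_grad_near) [leLHS]/Num.norm/= mx_normrE.
apply/bigmax_leP; split => /= [|[j i] _]; first by rewrite mulr_ge0// ltW.
by have := Ny i; rewrite DN (ord1 j) /N /GRing.mul/= /G /g !mxE.
Qed.



End unit_gradient.

(** * The Weingarten map *)

Section weingarten_map.
Context {R : realType} {n : nat} (K : set 'rV[R]_n).
Hypotheses (cbK : convex_body K) (K0 : K° 0).

Lemma weingartenP x W : weingarten K x W <->
  (forall e, 0 < e -> \forall y \near x, boundary K y ->
     `|gauss_map K y - gauss_map K x - (y - x) *m W| <= e * `|y - x|) /\
  gauss_map K x *m W = gauss_map K x.
Proof.
split=> -[gW nW]; split => //; first by move/eqoP : gW.
by apply/eqoP => e e0; exact: gW.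
Qed.

(* The Weingarten map on the tangent space, completed by the identity on the
   normal line. *)
Definition weingarten_mx (f : 'rV[R]_n -> R) x : 'M[R]_n :=
  let nu := unit_grad f x in
  (1%:M - nu^T *m nu) *m shape_mx f x + nu^T *m nu.

Section chart.
Context (U : set 'rV[R]_n) (f : 'rV[R]_n -> R).
Hypothesis KUf : C2_chart K U f.

Section at_point.
Context (x : 'rV[R]_n).
Hypotheses (bKx : boundary K x) (Ux : U x).

Let oU : open U. Proof. by case: KUf. Qed.
Let C2f : class_C2 U f. Proof. by case: KUf. Qed.

Let g := grad f x.
Let nu := unit_grad f x.

Let xg0 : dotp x g != 0. Proof. exact: (dotp_grad_neq0 K cbK K0 U). Qed.

Let nu1 : dotp nu nu = 1.
Proof.
by have [/enorm1_dotp] := outer_normal_unit_grad K cbK K0 U f x KUf bKx Ux.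
Qed.

Let nuE : exists2 c, c != 0 & nu = c *: g.
Proof.
exists (Num.sg (dotp x g) / enorm g) => //.
have gne0 : g != 0 by apply: contra xg0 => /eqP ->; rewrite dotpC dotp0l.
by rewrite mulf_neq0 ?sgr_eq0// invr_eq0 gt_eqF// enorm_gt0.
Qed.

Lemma gauss_map_near :
  \forall y \near x, boundary K y -> gauss_map K y = unit_grad f y.
Proof.
have : nbhs x U by exact: open_nbhs_nbhs.
by apply: filterS => y Uy by_; exact: (gauss_map_unit_grad K cbK K0 U).
Qed.

(** [f] vanishes at both [x] and [y], so the linear part of its increment, proportional to
    [dotp (y - x) nu], is as small as the remainder. *)
Lemma dotp_normal_near e : 0 < e ->
  \forall y \near x, boundary K y -> `|dotp (y - x) nu| <= e * `|y - x|.
Proof.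
move=> e0; have [c c0 nuc] := nuE.
have ec0 : 0 < e / `|c| by rewrite divr_gt0// normr_gt0.
have dfx : differentiable f x by have [] := C2f _ Ux.
have nU : nbhs x U by exact: open_nbhs_nbhs.
apply: filterS2 nU (@diff_near _ _ _ f x _ dfx ec0) => y Uy.
case: KUf => _ _ _ /seteqP[KUf0 _] + bKy.
have [-> _] := KUf0 y (conj bKy Uy); have [-> _] := KUf0 x (conj bKx Ux).
rewrite subrr sub0r normrN -deriveE// derive_grad// -/g nuc dotpZr normrM.
by rewrite -ler_pdivlMl ?normr_gt0// mulrA [_^-1 * _]mulrC.
Qed.

(** [weingarten_mx] and [shape_mx] differ only on the normal component: the discrepancy on [h] is
    [dotp h nu *: v], negligible along the boundary by [dotp_normal_near]. *)
Lemma weingarten_mxP : weingarten K x (weingarten_mx f x).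
Proof.
apply/weingartenP; split; last first.
  rewrite (nbhs_singleton gauss_map_near)// /weingarten_mx/= -/nu.
  rewrite mulmxDr !mulmxA mulmxBr mulmx1 mulmxA (_ : nu *m nu^T = 1) ?mul1mx ?subrr ?mul0mx ?add0r//.
  by apply/rowP => i; rewrite !ord1 -dotpE nu1 mxE.
move=> e e0; set v := nu *m shape_mx f x - nu.
have v0 : 0 < `|v| + 1 by rewrite ltr_wpDl.
have e20 : 0 < e / 2 by rewrite divr_gt0.
have ev0 : 0 < e / 2 / (`|v| + 1) by rewrite divr_gt0.
have near_nu := unit_grad_expansion U f x C2f Ux xg0 _ e20.
apply: filterS3 gauss_map_near near_nu (dotp_normal_near _ ev0).
move=> y gy Ny ny bKy; rewrite gy// (nbhs_singleton gauss_map_near)//.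
set h := y - x; rewrite -/h in Ny ny *.
rewrite (_ : _ - _ = unit_grad f y - unit_grad f x - h *m shape_mx f x +
    dotp h nu *: v); last first.
  rewrite /weingarten_mx/= -/nu mulmxDr !mulmxA mulmxBr mulmx1 mulmxBl !mulmxA.
  rewrite (_ : h *m nu^T = (dotp h nu)%:M); last first.
    by apply/rowP => i; rewrite ord1 -dotpE mxE.
  by rewrite mul_scalar_mx -scalemxAl /v scalerBr !opprD opprK !addrA.
apply: (le_trans (ler_normD _ _)); rewrite [leRHS](_ : _ = e / 2 * `|h| +
  e / 2 / (`|v| + 1) * `|h| * (`|v| + 1)); last by field; rewrite gt_eqF.
by rewrite lerD// normrZ ler_pM ?ny// lerDl.
Qed.

(* Every tangent direction is the limit of directions of boundary points. *)
Lemma weingarten_unique W1 W2 : weingarten K x W1 -> weingarten K x W2 -> W1 = W2.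
Proof.
move=> /weingartenP[oW1 nW1] /weingartenP[oW2 nW2].
pose D := W1 - W2.
have oD e : 0 < e -> \forall y \near x, boundary K y -> `|(y - x) *m D| <= e * `|y - x|.
  move=> e0; have e20 : 0 < e / 2 by rewrite divr_gt0.
  apply: filterS2 (oW1 _ e20) (oW2 _ e20) => y oW1y oW2y bKy.
  rewrite [leRHS](_ : _ = e / 2 * `|y - x| + e / 2 * `|y - x|); last by field.
  apply: le_trans (lerD (oW1y bKy) (oW2y bKy)).
  rewrite -[X in _ <= X + _]normrN; apply: le_trans (ler_normD _ _).
  rewrite mulmxBr le_eqVlt; apply/orP; left; apply/eqP; congr `|_|.
  by rewrite opprB addrA subrK.
have nuD : nu *m D = 0.
  by rewrite mulmxBr /nu -(nbhs_singleton gauss_map_near)// nW1 nW2 subrr.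
have gD : g *m D = 0.
  have [c c0 nuc] := nuE; apply: (scalerI c0).
  by rewrite scaler0 scalemxAl -nuc.
have gg : 0 < dotp g g.
  by rewrite dotp_gt0; apply: contra xg0 => /eqP ->; rewrite dotpC dotp0l.
have tauD tau : dotp tau g = 0 -> tau *m D = 0.
  move=> taug; apply/eqP; rewrite -normr_eq0 eq_le normr_ge0 andbT.
  apply/ler_addgt0Pr => e e0; rewrite add0r.
  pose M := `|tau| + `|g| + 1.
  have M0 : 0 < M by rewrite ltr_wpDl// addr_ge0.
  have eM0 : 0 < e / M by rewrite divr_gt0.
  have [r /= r0 rD] : nbhs_ball x [set y | boundary K y ->
    `|(y - x) *m D| <= e / M * `|y - x|] by apply/nbhs_ballP; exact: oD.
  (* No boundary point need lie exactly in the direction [tau]. Crossing from [tau + g] to [tau - g]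
     finds one in a direction [tau + c *: g], and [g *m D = 0] removes the error. *)
  have near_bd : \forall t \near 0^'+, exists2 l, 0 <= l <= 1 &
      boundary K (x + t *: (l *: (tau + g) + (1 - l) *: (tau - g))).
    apply: (boundary_crossing K U f x KUf bKx Ux).
      by rewrite dotpDl taug add0r.
    by rewrite dotpBl taug sub0r oppr_lt0.
  near (0:R)^'+ => t; have t0 : 0 < t by [].
  have tM : t * M < r.
    by rewrite -ltr_pdivlMr//; near: t; apply: nbhs_right_lt; exact: divr_gt0.
  have [l l01 bd] : exists2 l, 0 <= l <= 1 &
    boundary K (x + t *: (l *: (tau + g) + (1 - l) *: (tau - g))) by near: t.
  set w := l *: _ + _ in bd.
  have wE : w = tau + (2 * l - 1) *: g.
    by apply/rowP => i; rewrite !mxE; ring.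
  have wM : `|w| <= M.
    rewrite wE (le_trans (ler_normD _ _))// /M -addrA lerD2l normrZ ler_wpDr//.
    by rewrite ler_piMl// ler_norml; case/andP: l01; lra.
  have : `|(x + t *: w - x) *m D| <= e / M * `|x + t *: w - x|.
    apply: rD bd; rewrite -ball_normE/= opprD addrA subrr sub0r normrN normrZ.
    by rewrite gtr0_norm// (le_lt_trans _ tM)// ler_pM2l.
  rewrite addrAC subrr add0r -scalemxAl !normrZ (gtr0_norm t0) mulrCA ler_pM2l//.
  rewrite {1}wE mulmxDl -scalemxAl gD scaler0 addr0 => /le_trans; apply.
  by rewrite -mulrA ler_piMr ?(ltW e0)// ler_pdivrMl// mulr1.
apply/eqP; rewrite -subr_eq0 -/D; apply/eqP/row_matrixP => i.
rewrite rowE row0; set v := delta_mx _ _.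
pose c := dotp v g / dotp g g.
rewrite -[v](subrK (c *: g)) mulmxDl -scalemxAl gD scaler0 addr0.
by apply: tauD; rewrite dotpBl dotpZl divfK ?subrr// gt_eqF.
Unshelve. all: by end_near. Qed.

Lemma gauss_curvatureE : gauss_curvature K x = \det (weingarten_mx f x).
Proof.
rewrite /gauss_curvature; congr (\det _); apply: xget_unique.
  exact: weingarten_mxP.
by move=> W; move/weingarten_unique => /(_ _ weingarten_mxP).
Qed.

End at_point.

Let cvg_boundary (T : topologicalType) (h H : 'rV[R]_n -> T) x : boundary K x ->
  (\forall y \near x, boundary K y -> h y = H y) -> {for x, continuous H} ->
  h y @[y --> within (boundary K) (nbhs x)] --> h x.
Proof.
move=> bKx hH cH; rewrite (nbhs_singleton hH)//.
apply: cvg_trans (cvg_within_filter _ cH); apply: near_eq_cvg.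
by apply: filterS hH => y hHy bKy; rewrite hHy.
Qed.

Let nbhs_chart x : U x -> nbhs x U.
Proof. by case: KUf => oU _ _ _ Ux; exact: open_nbhs_nbhs. Qed.

Lemma cvg_gauss_map x : boundary K x -> U x ->
  gauss_map K y @[y --> within (boundary K) (nbhs x)] --> gauss_map K x.
Proof.
move=> bKx Ux; have near_N := gauss_map_near x Ux.
apply: (cvg_boundary _ (gauss_map K) (unit_grad f) x bKx near_N).
case: (KUf) => oU C2f _ _; apply: (continuous_unit_grad U f x C2f Ux).
exact: (dotp_grad_neq0 K cbK K0 U f x KUf bKx Ux).
Qed.

(** A chart at [x] also serves the nearby boundary points, where the curvature is thus the
    determinant of one matrix field, continuous at [x]. *)
Lemma cvg_gauss_curvature x : boundary K x -> U x ->
  gauss_curvature K y @[y --> within (boundary K) (nbhs x)] --> gauss_curvature K x.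
Proof.
move=> bKx Ux.
have near_det : \forall y \near x, boundary K y ->
    gauss_curvature K y = \det (weingarten_mx f y).
  by apply: filterS (nbhs_chart _ Ux) => y Uy bKy; exact: gauss_curvatureE.
apply: (cvg_boundary _ (gauss_curvature K) (fun y => \det (weingarten_mx f y)) x
  bKx near_det).
case: (KUf) => oU C2f _ _; have xg0 := dotp_grad_neq0 K cbK K0 U f x KUf bKx Ux.
have cnu : {for x, continuous (unit_grad f)} by exact: (continuous_unit_grad U f x C2f Ux xg0).
have cS : {for x, continuous (shape_mx f)} by exact: (continuous_shape_mx U f x C2f Ux xg0).
have cnn : {for x, continuous (fun y => (unit_grad f y)^T *m unit_grad f y)}.
  exact: (@continuous_mulmx _ _ _ _ _ (fun y => (unit_grad f y)^T) (unit_grad f)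
    x (continuous_trmx _ _ _ _ cnu) cnu).
have cpi : {for x, continuous (fun y => 1%:M - (unit_grad f y)^T *m unit_grad f y)}.
  apply: (@cvgB _ _ _ (nbhs x) _ (cst 1%:M)); last exact: cnn.
  exact: cvg_cst.
apply: continuous_det.
apply: (@cvgD _ _ _ (nbhs x) _ (fun y =>
  (1%:M - (unit_grad f y)^T *m unit_grad f y) *m shape_mx f y)); last exact: cnn.
exact: (@continuous_mulmx _ _ _ _ _
  (fun y => 1%:M - (unit_grad f y)^T *m unit_grad f y) (shape_mx f) x cpi cS).
Qed.

End chart.

Section C2_plus.
Hypothesis C2K : C2_plus K.

Let chart x : boundary K x -> exists U f, C2_chart K U f /\ U x.
Proof.
by case: C2K => C2 _ /C2[U [f [oU Ux C2f fg KUf]]]; exists U, f.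
Qed.

Lemma gauss_map_outer_normal x : boundary K x -> outer_normal K x (gauss_map K x).
Proof.
move=> bKx; have [U [f [KUf Ux]]] := chart _ bKx.
rewrite (gauss_map_unit_grad K cbK K0 U f)//.
exact: (outer_normal_unit_grad K cbK K0 U).
Qed.

Lemma outer_normal_gauss_map x u : boundary K x -> outer_normal K x u ->
  u = gauss_map K x.
Proof.
move=> bKx xu; have [U [f [KUf Ux]]] := chart _ bKx.
rewrite (gauss_map_unit_grad K cbK K0 U f)//.
exact: (outer_normalE K cbK K0 U).
Qed.

Lemma continuous_gauss_map : {within boundary K, continuous (gauss_map K)}.
Proof.
apply/subspace_continuousP => x bKx; have [U [f [KUf Ux]]] := chart _ bKx.
exact: (cvg_gauss_map U f).
Qed.

Lemma continuous_gauss_curvature :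
  {within boundary K, continuous (gauss_curvature K)}.
Proof.
apply/subspace_continuousP => x bKx; have [U [f [KUf Ux]]] := chart _ bKx.
exact: (cvg_gauss_curvature U f).
Qed.

(** From an interior point one could move a little along [u] inside [K], increasing the product with
    [u]. *)
Lemma outer_normal_boundary x u : K x -> outer_normal K x u -> boundary K x.
Proof.
move=> Kx [u1 Ku]; rewrite boundaryE//; split=> // Kox.
have [e /= e0 eK] : nbhs_ball x K by exact/nbhs_ballP.
have nu0 : 0 < `|u| by rewrite normr_gt0 enorm1_neq0.
have : K (x + (e / 2 / `|u|) *: u).
  apply: eK; rewrite -ball_normE/= opprD addrA subrr sub0r normrN normrZ.
  rewrite ger0_norm; last by rewrite !divr_ge0// ltW.
  by rewrite divfK ?gt_eqF// ltr_pdivrMr// ltr_pMr// ltr1n.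
move/Ku; rewrite dotpDl gerDl dotpZl (enorm1_dotp _).1// mulr1.
by rewrite leNgt !divr_gt0.
Qed.

(* A segment of points with a common normal would be in the kernel of the
   Weingarten map. *)
Lemma gauss_map_inj x x' : boundary K x -> boundary K x' ->
  gauss_map K x = gauss_map K x' -> x = x'.
Proof.
move=> bKx bKx' gxx'; have [u1 Ku] := gauss_map_outer_normal _ bKx.
have [_ Ku'] := gauss_map_outer_normal _ bKx'.
set u := gauss_map K x in u1 Ku; rewrite -gxx' -/u in Ku'.
have [Kx Kx'] : K x /\ K x' by move: bKx bKx'; rewrite boundaryE// => -[? _] [].
have xx'u : dotp x u = dotp x' u by apply/eqP; rewrite eq_le Ku'// Ku.
(* Both ends attain the maximum of the product with [u] over [K], hence so does every point between
   them. *)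
have gauss_map_segment t : 0 < t < 1 -> boundary K (x + t *: (x' - x)) /\
    gauss_map K (x + t *: (x' - x)) = u.
  move=> /andP[t0 t1]; have nu : outer_normal K (x + t *: (x' - x)) u.
    by split => // y Ky; rewrite dotpDl dotpZl dotpBl xx'u subrr mulr0 addr0 -xx'u Ku.
  have bK : boundary K (x + t *: (x' - x)).
    apply: outer_normal_boundary nu.
    rewrite (_ : _ + _ = t *: x' + (1 - t) *: x).
      by apply: convex_setP => //; [case: cbK|rewrite (ltW t0) (ltW t1)].
    by apply/rowP => i; rewrite !mxE; ring.
  by split => //; rewrite -(outer_normal_gauss_map _ _ bK nu).
have [U [f [KUf Ux]]] := chart _ bKx.
have /weingartenP[oW _] := weingarten_mxP U f KUf x bKx Ux.
set W := weingarten_mx f x in oW.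
have detW : \det W != 0.
  by rewrite -(gauss_curvatureE U f KUf x bKx Ux) gt_eqF//; case: C2K => _; exact.
(* The Gauss map being constant on the segment, its expansion at [x] leaves [t *: (x' - x) *m W] no
   larger than the remainder; dividing by [t] puts the norm below every [e]. *)
suff : (x' - x) *m W = 0.
  have : W \in unitmx by rewrite unitmxE unitfE.
  move=> /mulmxK WK /(congr1 (mulmx^~ (invmx W))); rewrite mul0mx WK => /eqP.
  by rewrite subr_eq0 => /eqP.
apply/eqP; rewrite -normr_eq0 eq_le normr_ge0 andbT.
apply/ler_addgt0Pr => e e0; rewrite add0r.
pose M := `|x' - x| + 1; have M0 : 0 < M by rewrite ltr_wpDl.
have eM0 : 0 < e / M by rewrite divr_gt0.
have [r /= r0 rW] : nbhs_ball x [set y | boundary K y ->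
    `|gauss_map K y - gauss_map K x - (y - x) *m W| <= e / M * `|y - x|].
  by apply/nbhs_ballP; exact: oW.
near (0:R)^'+ => t; have t0 : 0 < t by [].
have t1 : t < 1 by near: t; exact: nbhs_right_lt.
have tM : t * M < r.
  by rewrite -ltr_pdivlMr//; near: t; apply: nbhs_right_lt; exact: divr_gt0.
have [bKt gt] : boundary K (x + t *: (x' - x)) /\
    gauss_map K (x + t *: (x' - x)) = u by apply: gauss_map_segment; rewrite t0.
have xtx : x + t *: (x' - x) - x = t *: (x' - x) by rewrite addrAC subrr add0r.
have xx'M : `|x' - x| <= M by rewrite lerDl.
have : `|gauss_map K (x + t *: (x' - x)) - gauss_map K x - t *: (x' - x) *m W| <=
    e / M * `|t *: (x' - x)|.
  have xt_ball : ball x r (x + t *: (x' - x)).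
    rewrite -ball_normE/= distrC xtx normrZ gtr0_norm//.
    by rewrite (le_lt_trans _ tM)// ler_pM2l.
  by have := rW _ xt_ball bKt; rewrite xtx.
rewrite gt -/u subrr sub0r normrN -scalemxAl !normrZ (gtr0_norm t0) mulrCA ler_pM2l//.
by move=> /le_trans; apply; rewrite -mulrA ler_piMr ?(ltW e0)// ler_pdivrMl// mulr1.
Unshelve. all: by end_near. Qed.

End C2_plus.
End weingarten_map.

(** * Boundary points with a given outer normal *)

Lemma compact_positive_bounds {R : realType} {T : topologicalType} (A : set T)
    (h : T -> R) : compact A -> {within A, continuous h} ->
  (forall x, A x -> 0 < h x) ->
  exists a b, [/\ 0 < a, 0 < b & forall x, A x -> a <= h x <= b].
Proof.
move=> cA ch h0; have [A0|/nonemptyPn A0] := pselect (A !=set0); last first.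
  by exists 1, 1; split => // x; rewrite A0.
have [x /set_mem Ax xmin] := compact_EVT_min A0 cA ch.
have [y /set_mem Ay ymax] := compact_EVT_max A0 cA ch.
exists (h x), (h y); split; [exact: h0|exact: h0|move=> z Az].
by rewrite xmin ?ymax//; exact/mem_set.
Qed.

Section normal_points.
Context {R : realType} {n : nat} (K : set 'rV[R]_n).
Hypotheses (cbK : convex_body K) (K0 : K° 0) (C2K : C2_plus K).

Let maximizer u : exists2 x, K x & forall y, K y -> dotp y u <= dotp x u.
Proof.
case: (cbK) => cK _ [z zK]; have [||x /set_mem Kx xmax] :=
    @compact_EVT_max _ R (fun x => dotp x u) K _ cK.
- by exists z; exact: interior_subset.
- apply: continuous_subspaceT => x.
  apply: (@continuous_dotp _ _ _ id (cst u)); first exact: cvg_id.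
  exact: cst_continuous.
- by exists x => // y Ky; apply: xmax; exact/mem_set.
Qed.

Lemma normal_pointP u : sphere R n u ->
  boundary K (normal_point K u) /\ outer_normal K (normal_point K u) u.
Proof.
move=> u1; have := @xgetPex _ 0 [set x | boundary K x /\ outer_normal K x u].
apply; have [x Kx xmax] := maximizer u.
have nx : outer_normal K x u by split.
by exists x; split => //; exact: (outer_normal_boundary K cbK x u Kx nx).
Qed.

Lemma gauss_map_normal_point u : sphere R n u -> gauss_map K (normal_point K u) = u.
Proof.
by move=> /normal_pointP[bK nK]; rewrite -(outer_normal_gauss_map K cbK K0 C2K _ _ bK nK).
Qed.

Lemma sphere_gauss_map x : boundary K x -> sphere R n (gauss_map K x).
Proof. by move=> /(gauss_map_outer_normal K cbK K0 C2K)[]. Qed.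

(** Injectivity turns the choice made by [normal_point] into the inverse of the Gauss map. *)
Lemma normal_point_gauss_map x : boundary K x -> normal_point K (gauss_map K x) = x.
Proof.
move=> bKx; have S := sphere_gauss_map _ bKx.
apply: (gauss_map_inj K cbK K0 C2K) => //; first by have [] := normal_pointP _ S.
exact: gauss_map_normal_point.
Qed.

(** The set is the image under the Gauss map of a superlevel set of [h] on the boundary, which is
    compact. This is how continuity on the boundary becomes measurability on the sphere. *)
Lemma closed_sphere_superlevel (h : 'rV[R]_n -> R) c :
  {within boundary K, continuous h} ->
  closed [set u | sphere R n u /\ c <= h (normal_point K u)].
Proof.
move=> ch; pose B := [set x | boundary K x /\ c <= h x].
have cbd := compact_boundary K cbK.
have clB : closed B.
  move=> x clx; have bKx : boundary K x.
    apply: (compact_closed (@norm_hausdorff _ _) cbd).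
    by apply: closure_subset clx => y [].
  split => //; rewrite leNgt; apply/negP => hxc.
  have /subspace_continuousP/(_ _ bKx)/cvgr_lt/(_ _ hxc) := ch.
  move=> /clx[y [[bKy chy] hyc]].
  by have := hyc bKy; rewrite ltNge chy.
have cB : compact B.
  by apply: subclosed_compact clB cbd _ => x [].
rewrite (_ : [set u | _] = gauss_map K @` B).
  apply: (compact_closed (@norm_hausdorff _ _)); apply: continuous_compact => //.
  by apply: continuous_subspaceW (continuous_gauss_map K cbK K0 C2K) => x [].
apply/seteqP; split => [u [u1 cu]|_ [x [bKx cx] <-]].
  exists (normal_point K u); last exact: gauss_map_normal_point.
  by split => //; have [] := normal_pointP _ u1.
by split; [exact: sphere_gauss_map|rewrite normal_point_gauss_map].
Qed.

Lemma support_normal_point u : sphere R n u -> Defs.support K u = dotp (normal_point K u) u.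
Proof.
move=> /normal_pointP[bK [_ Ku]]; rewrite /Defs.support.
have Kx : K (normal_point K u) by move: bK; rewrite boundaryE// => -[].
apply/eqP; rewrite eq_le; apply/andP; split.
  apply: ge_sup; first by exists (dotp (normal_point K u) u), (normal_point K u).
  by move=> _ [y Ky <-]; exact: Ku.
apply: ub_le_sup; last by exists (normal_point K u).
by exists (dotp (normal_point K u) u) => _ [y Ky <-]; exact: Ku.
Qed.

Lemma curvature_bounds :
  exists a b, [/\ 0 < a, 0 < b & forall u, sphere R n u -> a <= curvature K u <= b].
Proof.
have [a [b [a0 b0 H]]] := compact_positive_bounds _ _ (compact_boundary K cbK)
  (continuous_gauss_curvature K cbK K0 C2K) C2K.2.
by exists a, b; split => // u /normal_pointP[bK _]; exact: H.
Qed.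

Lemma continuous_dotp_gauss_map :
  {within boundary K, continuous (fun x => dotp x (gauss_map K x))}.
Proof.
move=> x; apply: (@continuous_dotp _ _ (subspace (boundary K)) id (gauss_map K)).
  by apply: (@continuous_subspaceT _ _ _ id) => y; exact: cvg_id.
exact: continuous_gauss_map.
Qed.

(** Transported to the boundary, the support function is [dotp x (gauss_map K x)], continuous and
    positive on a compact set. *)
Lemma support_bounds :
  exists a b, [/\ 0 < a, 0 < b & forall u, sphere R n u -> a <= Defs.support K u <= b].
Proof.
have [x|a [b [a0 b0 H]]] := compact_positive_bounds _ _ (compact_boundary K cbK)
  continuous_dotp_gauss_map.
  move=> bKx; apply: (outer_normal_gt0 _ K0).
  exact: (gauss_map_outer_normal K cbK K0 C2K).
exists a, b; split => // u u1; have [bK _] := normal_pointP _ u1.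
by rewrite support_normal_point// -[X in dotp _ X]gauss_map_normal_point//; exact: H.
Qed.

(** The polar body is star-shaped with radial function the inverse of the support function; this
    feeds polar coordinates. *)
Lemma polar_support (y : 'rV[R]_n) : y != 0 ->
  polar K y <-> enorm y <= (Defs.support K (normalize y))^-1.
Proof.
move=> y0; have S : sphere R n (normalize y) by exact: enorm_normalize.
have ey : 0 < enorm y by rewrite enorm_gt0.
have yE x : dotp x y = enorm y * dotp x (normalize y).
  by rewrite dotpZr mulrA divff ?mul1r// gt_eqF.
have [bK nK] := normal_pointP _ S; have h0 := outer_normal_gt0 _ K0 _ _ nK.
have Kx : K (normal_point K (normalize y)) by move: bK; rewrite boundaryE// => -[].
rewrite support_normal_point// -[X in _ <= X]mul1r ler_pdivlMr//.
split=> [/(_ _ Kx)|yh x Kx']; first by rewrite yE.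
rewrite yE (le_trans _ yh)// ler_pM2l//.
by case: nK => _; exact.
Qed.

End normal_points.

(** * Lebesgue measure and polar coordinates *)

Section borel.
Context {R : realType} {n : nat}.

Let box (p : 'rV[rat]_n * nat) : set 'rV[R]_n :=
  \bigcap_(i in [set: 'I_n])
    (fun x : 'rV[R]_n => x 0 i) @^-1` ball (ratr (p.1 0 i) : R) p.2.+1%:R^-1.

Let measurable_box p : measurable (box p).
Proof.
apply: fin_bigcap_measurable => // i _.
rewrite -[X in measurable X]setTI; apply: measurable_coor => //.
by apply: open_measurable; exact: ball_open.
Qed.

(** The sigma-algebra is generated by the coordinates, so an open set is written as the countable
    union of the boxes with rational centres that it contains. *)
Lemma open_measurable_rV (O : set 'rV[R]_n) : open O -> measurable O.
Proof.
move=> oO; pose F p := if `[< box p `<=` O >] then box p else set0.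
rewrite (_ : O = \bigcup_p F p); last first.
  apply/seteqP; split => [x Ox|x [p _]]; last first.
    by rewrite /F; case: ifPn => // /asboolP pO /pO.
  have [e /= e0 eO] : nbhs_ball x O by apply/nbhs_ballP; exact: open_nbhs_nbhs.
  (* Half of [e], since both [x] and [y] are only known to be close to the rational centre. *)
  have [k ke] : exists k, k.+1%:R^-1 < e / 2.
    have e20 : 0 < e / 2 by rewrite divr_gt0.
    have [k _] := near_infty_natSinv_lt (PosNum e20).
    by move=> /(_ k (leqnn _)); exists k.
  have k0 : 0 < k.+1%:R^-1 :> R by rewrite invr_gt0.
  have /choice[q qx] (i : 'I_n) : exists q : rat, `|ratr q - x 0 i| < k.+1%:R^-1.
    have : x 0 i - k.+1%:R^-1 < x 0 i by rewrite ltrBlDr ltrDl.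
    move=> /rat_in_itvoo[q]; rewrite in_itv/= => /andP[q1 q2]; exists q.
    by rewrite ltr_norml ltrBlDr ltrBrDr (lt_trans q2) ?ltrDr//= addrC q1.
  exists (\row_i q i, k) => //.
  have bx : box (\row_i q i, k) x by move=> i _; rewrite /ball/= mxE; exact: qx.
  rewrite /F asboolT// => y /= by_; apply: eO.
  rewrite -ball_normE/= [ltLHS]/Num.norm/= mx_normrE.
  apply/bigmax_ltP; split => // -[j i] _; rewrite (ord1 j) !mxE/=.
  have := by_ i I; have := qx i; rewrite /ball/= mxE; move: (ratr _) => z.
  rewrite (distrC z (x 0 i)) => xz zy.
  by rewrite (le_lt_trans (ler_distD z _ _))// [e]splitr ltrD// (lt_trans _ ke).
apply: countable_bigcupT_measurable => [|p]; first exact: countableP.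
by rewrite /F; case: ifP.
Qed.

Lemma closed_measurable_rV (C : set 'rV[R]_n) : closed C -> measurable C.
Proof.
move=> cC; rewrite -(setCK C); apply: measurableC.
by apply: open_measurable_rV; rewrite openC.
Qed.

Lemma measurable_sphere : measurable (sphere R n).
Proof.
rewrite (_ : sphere R n = enorm @^-1` [set 1]) // -[X in measurable X]setTI.
exact: (measurable_enorm _ (measurable_set1 _)).
Qed.

End borel.

Definition pushforward_measure {d d'} {T1 : measurableType d}
    {T2 : measurableType d'} {R : realType} (m : {measure set T1 -> \bar R})
    {f : T1 -> T2} (mf : measurable_fun setT f) : {measure set T2 -> \bar R} :=
  measure_function_pushforward__canonical__measure_function_Measure m mf.

Section scaling.
Context {R : realType}.

Let measurable_mulr (r : R) :
  measurable_fun setT (fun t : measurableTypeR R => r * t : measurableTypeR R).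
Proof. exact: mulrl_measurable. Qed.

Lemma measurable_scale_rV n (r : R) :
  measurable_fun setT (fun x : 'rV[R]_n => r *: x).
Proof.
apply/measurable_fun_coorP => i.
rewrite (_ : (fun x => _) = (fun x : 'rV[R]_n => r * x 0 i : measurableTypeR R)).
  exact: (measurableT_comp (measurable_mulr r) (measurable_coor i)).
by apply/funext => x; rewrite mxE.
Qed.

(** Scaling the pushforward by [r] gives a measure that agrees with Lebesgue measure on half-open
    intervals. *)
Let lebesgue_scale1 (r : R) A : 0 < r -> measurable A ->
  (r%:E * lebesgue_measure ((fun t : measurableTypeR R => (r * t)%R) @^-1` A) =
   lebesgue_measure A)%E.
Proof.
move=> r0 mA.
pose r' : {nonneg R} := NngNum (ltW r0).
pose m' : {measure set measurableTypeR R -> \bar R} :=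
  mscale r' (pushforward_measure lebesgue_measure (measurable_mulr r)).
rewrite -[LHS]/(m' A); apply/esym; apply: lebesgue_measure_unique => // X.
move=> [[a b] _ <-].
have -> : m' [set` `]a, b]%R] = (r%:E * lebesgue_measure [set` `](a / r)%R, (b / r)%R]%R])%E.
  congr (_ * lebesgue_measure _)%E; apply/seteqP; split => x /=; rewrite !in_itv/=.
    by rewrite ltr_pdivrMr// ler_pdivlMr// ![x * r]mulrC.
  by rewrite ltr_pdivrMr// ler_pdivlMr// ![x * r]mulrC.
rewrite !lebesgue_measure_itv/= !lte_fin ltr_pM2r ?invr_gt0//.
case: ifPn => ab; last by rewrite mule0.
rewrite -!EFinD -EFinM -mulrBl; congr (_%:E); field; exact: lt0r_neq0.
Qed.

(** By induction on the dimension: uniqueness of the product measure reduces the step to rectangles,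
    where the factors [r] and [r ^+ n] multiply. *)
Lemma lebesgue_rV_scale n (r : R) (A : set 'rV[R]_n) : 0 < r -> measurable A ->
  ((r ^+ n)%:E * lebesgue_rV n (( *:%R r) @^-1` A) = lebesgue_rV n A)%E.
Proof.
move=> r0; elim: n A => [A mA|n IH A mA].
  rewrite expr0 mul1e/= /dirac/= !indicE; congr (_%:R%:E).
  by congr nat_of_bool; apply/idP/idP; rewrite !inE/= scaler0.
pose Phi (p : measurableTypeR R * 'rV[R]_n) : measurableTypeR R * 'rV[R]_n :=
  (r * p.1, r *: p.2).
have mPhi : measurable_fun setT Phi.
  apply/measurable_fun_pairP; split.
    exact: (measurableT_comp (measurable_mulr r) measurable_fst).
  exact: (measurableT_comp (measurable_scale_rV n r) measurable_snd).
pose s1 (t : measurableTypeR R) : measurableTypeR R := r * t.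
have r'0 : 0 <= r ^+ n.+1 by rewrite exprn_ge0// ltW.
pose m' : {measure set (measurableTypeR R * 'rV[R]_n) -> \bar R} :=
  mscale (NngNum r'0)
    (pushforward_measure (lebesgue_measure \x lebesgue_rV n)%E mPhi).
have mX : measurable (@cons_rV R n @^-1` A).
  by rewrite -[X in measurable X]setTI; exact: measurable_cons_rV.
have -> : (lebesgue_rV n.+1 A =
    (lebesgue_measure \x lebesgue_rV n)%E (@cons_rV R n @^-1` A)) by [].
rewrite (product_measure_unique (m' := m'))//; last first.
  move=> B C mB mC.
  have -> : m' (B `*` C) = ((r ^+ n.+1)%:E * (lebesgue_measure \x lebesgue_rV n)%E
      ((s1 @^-1` B) `*` (( *:%R r) @^-1` C)))%E by [].
  have mB' : measurable (s1 @^-1` B).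
    by rewrite -[X in measurable X]setTI; exact: measurable_mulr.
  have mC' : measurable (( *:%R r) @^-1` C : set 'rV[R]_n).
    by rewrite -[X in measurable X]setTI; exact: measurable_scale_rV.
  rewrite product_measure1E// -[RHS]/(lebesgue_measure B * lebesgue_rV n C)%E.
  rewrite -(lebesgue_scale1 _ _ r0 mB) -(IH _ mC).
  by rewrite exprS EFinM muleACA.
congr (_ * (lebesgue_measure \x lebesgue_rV n) _)%E.
have PhiE p : r *: cons_rV p = cons_rV (Phi p).
  by apply/rowP => i; rewrite /cons_rV !mxE; case: splitP => j _; rewrite !mxE.
by apply/seteqP; split => p /=; rewrite PhiE.
Qed.

Definition cube n (M : R) : set 'rV[R]_n := [set x | forall i, `|x 0 i| <= M].

Lemma measurable_cube n M : measurable (cube n M).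
Proof.
rewrite (_ : cube n M = \bigcap_(i in [set: 'I_n])
    (fun x : 'rV[R]_n => x 0 i : measurableTypeR R) @^-1` `[- M, M]%classic).
  apply: fin_bigcap_measurable => // i _.
  by rewrite -[X in measurable X]setTI; apply: measurable_coor.
apply/seteqP; split => x /= H i => [_|]; first by rewrite /= in_itv/= -ler_norml.
by have := H i I; rewrite /= in_itv/= -ler_norml.
Qed.

(** This gives finiteness on bounded sets, needed for the spherical measure and for the mass of the
    origin. *)
Lemma lebesgue_cube_lty n (M : R) : (lebesgue_rV n (cube n M) < +oo)%E.
Proof.
elim: n => [|n IH]; first by rewrite /= /dirac/= ltry.
have -> : lebesgue_rV n.+1 (cube n.+1 M) =
    (lebesgue_measure \x lebesgue_rV n)%E ([set` `[- M, M]%R] `*` cube n M).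
  congr ((lebesgue_measure \x lebesgue_rV n)%E _).
  apply/seteqP; split => -[t y] /= H; last first.
    move=> i; rewrite /cons_rV mxE; case: splitP => j _; rewrite ?mxE/=.
      by move: H; rewrite in_itv/= -ler_norml => -[].
    by case: H.
  have [tE yE] : cons_rV (t, y) 0 0 = t /\ rsubmx (cons_rV (t, y) : 'rV_(1 + n)) = y.
    by have [] := cons_rVK (t, y).
  split; first by rewrite in_itv/= -ler_norml -{1}tE.
  by move=> i; rewrite -yE mxE.
have LI : (lebesgue_measure ([set` `[- M, M]%R] : set R) < +oo)%E.
  by rewrite lebesgue_measure_itv/=; case: ifP => //; rewrite ltry.
rewrite product_measure1E//; last exact: measurable_cube.
by rewrite lte_mul_pinfty// ge0_fin_numE//; exact: LI.
Qed.

End scaling.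

Lemma exists_exp_gt {R : realType} (q x : R) : 1 < q -> exists k, x < q ^+ k.
Proof.
move=> q1; have d0 : 0 < q - 1 by rewrite subr_gt0.
have bern k : k%:R * (q - 1) + 1 <= q ^+ k.
  elim: k => [|k IH]; first by rewrite mul0r add0r expr0.
  rewrite exprS; apply: (@le_trans _ _ (q * (k%:R * (q - 1) + 1))).
    have : 0 <= k%:R * (q - 1) ^+ 2 by rewrite mulr_ge0// sqr_ge0.
    by rewrite -natr1; lra.
  by rewrite ler_pM2l// (lt_trans ltr01).
exists (Num.truncn (x / (q - 1))).+1; apply: lt_le_trans (bern _).
by rewrite ltr_pwDr// -ler_pdivrMr// ltW// truncnS_gt.
Qed.

(** Let [q] decrease to 1; this closes the slicing estimates. *)
Lemma le_mul_exp_le {R : realType} n (x y : R) :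
  (forall q, 1 < q -> x <= q ^+ n * y) -> x <= y.
Proof.
move=> xy; rewrite -[y]mul1r -(expr1n _ n).
have cv : q ^+ n * y @[q --> 1^'+] --> 1 ^+ n * y.
  apply: cvg_at_right_filter; apply: cvgMl; exact: exprn_continuous.
rewrite -(cvg_lim _ cv)//; apply: limr_ge; first by apply/cvg_ex; eexists; exact: cv.
by near=> q; apply: xy.
Unshelve. all: by end_near. Qed.

Section polar_coordinates.
Context {R : realType} {n : nat}.
Implicit Types A : set 'rV[R]_n.

Lemma measurable_normalize_preimage A : measurable A ->
  measurable (@normalize R n @^-1` A).
Proof. by move=> mA; rewrite -[X in measurable X]setTI; exact: measurable_normalize. Qed.

Lemma measurable_enorm_le (d : R) : measurable [set x : 'rV[R]_n | enorm x <= d].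
Proof.
rewrite (_ : [set x | _] = setT `&` enorm @^-1` `]-oo, d]%classic).
  exact: (measurable_enorm measurableT (measurable_itv _)).
by rewrite setTI; apply/seteqP; split => x /=; rewrite in_itv.
Qed.

Lemma normalize_sphere_neq0 (x : 'rV[R]_n) : sphere R n (normalize x) -> x != 0.
Proof. by move=> /enorm1_neq0; apply: contra => /eqP ->; rewrite /normalize scaler0. Qed.

Lemma cone_volume_scale A d : 0 < d -> measurable A -> A `<=` sphere R n ->
  lebesgue_rV n (normalize @^-1` A `&` [set x | enorm x <= d]) =
  ((d ^+ n)%:E * cone_volume A)%E.
Proof.
move=> d0 mA AS; rewrite -(lebesgue_rV_scale _ d)//; last first.
  apply: measurableI; first exact: measurable_normalize_preimage.
  exact: measurable_enorm_le.
congr (_ * lebesgue_rV n _)%E; apply/seteqP; split => x /=.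
  rewrite normalizeZ// enormZ gtr0_norm// => -[Ax xd]; split => //.
  (* The origin is excluded automatically: its normalization is [0], which is off the sphere. *)
  rewrite /punctured_ball/= enorm_gt0 (normalize_sphere_neq0 _ (AS _ Ax))/=.
  by move: xd; rewrite -ler_pdivlMl// mulVf ?gt_eqF.
rewrite normalizeZ// enormZ gtr0_norm// => -[Ax /andP[_ x1]]; split => //.
by rewrite ler_piMr// ltW.
Qed.

Lemma cone_volume_sphere_lty : (cone_volume (sphere R n) < +oo)%E.
Proof.
apply: le_lt_trans (lebesgue_cube_lty n 1); apply: le_measure; rewrite ?inE.
- apply: measurableI; last exact: measurable_punctured_ball.
  by apply: measurable_normalize_preimage; exact: measurable_sphere.
- exact: measurable_cube.
- move=> x [_ /andP[_ x1]] i.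
  exact: le_trans (le_coord_norm _ _) (le_trans (le_norm_enorm _) x1).
Qed.

Section star_shaped.
Context (rho : 'rV[R]_n -> R) (a b : R).
Hypotheses (mrho : measurable_fun (sphere R n) rho) (a0 : 0 < a).
Hypothesis rho_ab : forall u, sphere R n u -> a <= rho u <= b.

Definition star A : set 'rV[R]_n :=
  normalize @^-1` A `&` [set x | enorm x <= rho (normalize x)].

Lemma measurable_star A : measurable A -> A `<=` sphere R n -> measurable (star A).
Proof.
move=> mA AS.
pose D := normalize @^-1` A : set 'rV[R]_n.
have mD : measurable D by exact: measurable_normalize_preimage.
have mf : measurable_fun D (fun x => rho (normalize x) - enorm x).
  apply: measurable_funB; last first.
    by apply: measurable_funS (@measurable_enorm R n).
  apply: (@measurable_comp _ _ _ _ _ _ (sphere R n)) => //.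
  - exact: measurable_sphere.
  - by move=> _ [x Dx <-]; exact: AS.
  - by apply: measurable_funS (@measurable_normalize R n).
rewrite (_ : star A = D `&` (fun x => rho (normalize x) - enorm x) @^-1` `[0, +oo[%classic).
  exact: mf.
by apply/seteqP; split => x /= [Dx]; rewrite in_itv/= andbT subr_ge0.
Qed.

Let rho0 u : sphere R n u -> 0 <= rho u.
Proof. by move=> /rho_ab/andP[+ _]; apply: le_trans; exact: ltW. Qed.

Let mrhon A : measurable A -> A `<=` sphere R n ->
  measurable_fun A (fun u => (rho u ^+ n)%:E).
Proof.
move=> mA AS; apply/measurable_EFinP; apply: measurable_funX.
by apply: measurable_funS mrho => //; exact: measurable_sphere.
Qed.

(** Over [A] the star-shaped set contains the cone of radius [c] and lies in the cone of radius [d].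
    The integral obeys the same bounds, whence the comparison on each slice. *)
Let star_between A c d : measurable A -> A `<=` sphere R n -> 0 < c -> 0 < d ->
  (forall u, A u -> c <= rho u <= d) ->
  ((c ^+ n)%:E * cone_volume A <= lebesgue_rV n (star A) <=
   (d ^+ n)%:E * cone_volume A)%E.
Proof.
move=> mA AS c0 d0 cd; have mS := measurable_star _ mA AS.
rewrite -!cone_volume_scale//; apply/andP; split; apply: le_measure; rewrite ?inE//.
- by apply: measurableI; [exact: measurable_normalize_preimage|exact: measurable_enorm_le].
- by move=> x [Ax /= xc]; split => //; have /andP[+ _] := cd _ Ax; exact: le_trans.
- by apply: measurableI; [exact: measurable_normalize_preimage|exact: measurable_enorm_le].
- by move=> x [Ax /= xc]; split => //; have /andP[_ +] := cd _ Ax; exact: le_trans.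
Qed.

Let integral_between A c d : measurable A -> A `<=` sphere R n -> 0 < c -> 0 < d ->
  (forall u, A u -> c <= rho u <= d) ->
  ((c ^+ n)%:E * cone_volume A <= \int[cone_volume]_(u in A) (rho u ^+ n)%:E <=
   (d ^+ n)%:E * cone_volume A)%E.
Proof.
move=> mA AS c0 d0 cd.
rewrite -!(integral_cst _ mA); apply/andP; split; apply: ge0_le_integral => //.
- by move=> u _; rewrite /= lee_fin exprn_ge0// ltW.
- exact: mrhon.
- move=> u Au; rewrite /= lee_fin; have /andP[cu _] := cd _ Au.
  by rewrite lerXn2r// ?nnegrE ?(ltW c0)// (le_trans (ltW c0)).
- by move=> u Au; rewrite lee_fin exprn_ge0// rho0//; exact: AS.
- exact: mrhon.
- move=> u Au; rewrite /= lee_fin; have /andP[cu ud] := cd _ Au.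
  by rewrite lerXn2r// ?nnegrE ?(ltW d0)// (le_trans (ltW c0)).
Qed.

(* The sphere is cut into slices on which rho is constant up to a factor q;
   q then tends to 1. *)
Section slices.
Context (q : R).
Hypothesis q1 : 1 < q.

Let slice k : set 'rV[R]_n := sphere R n `&` rho @^-1` `[a * q ^+ k, a * q ^+ k.+1[%classic.

Let mslice k : measurable (slice k).
Proof. by apply: mrho => //; exact: measurable_sphere. Qed.

Let slice_sub k : slice k `<=` sphere R n. Proof. by move=> u []. Qed.

Let trivIset_slice : trivIset setT slice.
Proof.
apply/trivIsetP => i j _ _; wlog ij : i j / (i < j)%N => [H|_].
  rewrite neq_ltn => /orP[ij|ji]; first by apply: H; rewrite ?ltn_eqF.
  by rewrite setIC; apply: H; rewrite ?ltn_eqF.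
apply/seteqP; split => // u [[_ +] [_]].
rewrite /= !in_itv/= => /andP[_ u1] /andP[u2 _].
have := le_lt_trans u2 u1; rewrite ltr_pM2l// ltr_eXn2l//.
by rewrite ltnS leqNgt ij.
Qed.

Let bigcup_slice : \bigcup_k slice k = sphere R n.
Proof.
apply/seteqP; split => [u [k _ []]//|u Su].
have [k uk] := exists_exp_gt q (rho u / a) q1.
have ex : exists k, rho u < a * q ^+ k.
  by exists k; rewrite mulrC -ltr_pdivrMr.
(* The slice is found from the least power exceeding [rho u]; the exponent 0 is ruled out by the
   bound [a <= rho u]. *)
case: (ex_minnP ex) => -[|m] um mmin.
  move: um; rewrite expr0 mulr1; have /andP[au _] := rho_ab _ Su.
  by rewrite ltNge au.
exists m => //; split => //=; rewrite in_itv/= um andbT leNgt.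
by apply/negP => /mmin; rewrite ltnn.
Qed.

Let q0 : 0 < q. Proof. exact: lt_trans q1. Qed.

Let lebesgue_star_slices :
  lebesgue_rV n (star (sphere R n)) = (\sum_(0 <= k <oo) lebesgue_rV n (star (slice k)))%E.
Proof.
rewrite -bigcup_slice (_ : star (\bigcup_k slice k) = \bigcup_k star (slice k)).
  rewrite measure_bigcup//; first by apply: eq_eseriesl => k; rewrite in_setT.
    by move=> k _; exact: measurable_star.
  apply/trivIsetP => i j _ _ ij; move/trivIsetP : trivIset_slice => /(_ i j I I ij).
  move=> ij0; apply/seteqP; split => // x [[xi _] [xj _]].
  by have : (slice i `&` slice j) (normalize x) by []; rewrite ij0.
by rewrite /star preimage_bigcup setI_bigcupl.
Qed.

Let integral_slices : (\int[cone_volume]_(u in sphere R n) (rho u ^+ n)%:E =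
  \sum_(0 <= k <oo) \int[cone_volume]_(u in slice k) (rho u ^+ n)%:E)%E.
Proof.
rewrite -bigcup_slice ge0_integral_bigcup//.
  by rewrite bigcup_slice; apply: mrhon => //; exact: measurable_sphere.
by rewrite bigcup_slice => u Su; rewrite lee_fin exprn_ge0// rho0.
Qed.

Let slice_bounds k : [/\ 0 < a * q ^+ k, 0 < a * q ^+ k.+1 &
  forall u, slice k u -> a * q ^+ k <= rho u <= a * q ^+ k.+1].
Proof.
split; rewrite ?mulr_gt0 ?exprn_gt0// => u [_]; rewrite /= in_itv/= => /andP[-> /=].
exact: ltW.
Qed.

(** On a slice the two radii have ratio [q], so volume and integral, caught between the same bounds,
    differ by a factor at most [q ^+ n]. *)
Lemma lebesgue_star_le : (lebesgue_rV n (star (sphere R n)) <=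
  (q ^+ n)%:E * \int[cone_volume]_(u in sphere R n) (rho u ^+ n)%:E)%E.
Proof.
rewrite lebesgue_star_slices integral_slices -nneseriesZl; last first.
  by move=> k _; apply: integral_ge0 => u [Su _]; rewrite lee_fin exprn_ge0// rho0.
apply: lee_nneseries => // k _; have [c0 d0 cd] := slice_bounds k.
have /andP[_ h1] := star_between _ _ _ (mslice k) (slice_sub k) c0 d0 cd.
have /andP[h2 _] := integral_between _ _ _ (mslice k) (slice_sub k) c0 d0 cd.
apply: (le_trans h1); rewrite exprS mulrCA exprMn EFinM -muleA lee_pmul2l//.
by rewrite lte_fin exprn_gt0.
Qed.

Lemma integral_star_le : (\int[cone_volume]_(u in sphere R n) (rho u ^+ n)%:E <=
  (q ^+ n)%:E * lebesgue_rV n (star (sphere R n)))%E.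
Proof.
rewrite lebesgue_star_slices integral_slices -nneseriesZl//.
apply: lee_nneseries => [k _ _|k _].
  by apply: integral_ge0 => u [Su _]; rewrite lee_fin exprn_ge0// rho0.
have [c0 d0 cd] := slice_bounds k.
have /andP[h1 _] := star_between _ _ _ (mslice k) (slice_sub k) c0 d0 cd.
have /andP[_ h2] := integral_between _ _ _ (mslice k) (slice_sub k) c0 d0 cd.
apply: (le_trans h2); rewrite exprS mulrCA exprMn EFinM -muleA lee_pmul2l//.
by rewrite lte_fin exprn_gt0.
Qed.

End slices.

Lemma lebesgue_star : (lebesgue_rV n (star (sphere R n)) =
  \int[cone_volume]_(u in sphere R n) (rho u ^+ n)%:E)%E.
Proof.
have mS : measurable (sphere R n) := measurable_sphere.
(* The bound [b] alone may fail to be positive when the sphere is empty, in dimension 0. *)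
have d0 : 0 < Num.max a b by rewrite lt_max a0.
have rho_ad u : sphere R n u -> a <= rho u <= Num.max a b.
  by move=> /rho_ab/andP[-> ub]; rewrite le_max ub orbT.
have dlty : ((Num.max a b ^+ n)%:E * @cone_volume R n (sphere R n) < +oo)%E.
  by rewrite lte_mul_pinfty// ?lee_fin ?exprn_ge0 ?ltW// cone_volume_sphere_lty.
have /andP[_ /le_lt_trans/(_ dlty) xfin] :=
  star_between _ _ _ mS (@subset_refl _ _) a0 d0 rho_ad.
have /andP[_ /le_lt_trans/(_ dlty) yfin] :=
  integral_between _ _ _ mS (@subset_refl _ _) a0 d0 rho_ad.
have x0 : (0 <= lebesgue_rV n (star (sphere R n)))%E by exact: measure_ge0.
have y0 : (0 <= \int[cone_volume]_(u in sphere R n) (rho u ^+ n)%:E)%E.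
  by apply: integral_ge0 => u Su; rewrite lee_fin exprn_ge0// rho0.
have := lebesgue_star_le; have := integral_star_le.
move: xfin yfin x0 y0.
move: (lebesgue_rV n _) (\int[_]_(_ in _) _)%E => [x||] [y||]// _ _ _ _ yx xy.
congr (_%:E); apply/eqP; rewrite eq_le; apply/andP; split.
  by apply: (@le_mul_exp_le _ n) => q q1; rewrite -lee_fin EFinM xy.
by apply: (@le_mul_exp_le _ n) => q q1; rewrite -lee_fin EFinM yx.
Qed.

End star_shaped.

(** Doubling fixes the origin but multiplies its finite measure by [2 ^+ n], which is not 1. *)
Lemma lebesgue_rV0 : (0 < n)%N -> lebesgue_rV n [set 0 : 'rV[R]_n] = 0%E.
Proof.
move=> n0; have m0 : measurable [set 0 : 'rV[R]_n].
  exact: closed_measurable_rV (compact_closed (@norm_hausdorff _ _) (@compact_set1 _ _)).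
have lty : (lebesgue_rV n [set (0 : 'rV[R]_n)%R] < +oo)%E.
  apply: le_lt_trans (lebesgue_cube_lty n 0); apply: le_measure; rewrite ?inE//.
    exact: measurable_cube.
  by move=> _ -> i; rewrite mxE normr0.
have := lebesgue_rV_scale n 2 [set 0] (ltr0n _ 2) m0.
rewrite (_ : _ @^-1` _ = [set 0]); last first.
  by apply/seteqP; split => x /= => [/eqP|->]; rewrite ?scaler0// scaler_eq0 pnatr_eq0 => /eqP.
have : (0 <= lebesgue_rV n [set (0 : 'rV[R]_n)%R])%E by exact: measure_ge0.
move: lty; case: (lebesgue_rV n _) => // r _ _ [] /eqP.
rewrite -subr_eq0 -{2}[r]mul1r -mulrBl mulf_eq0 subr_eq0 => /orP[|/eqP->//].
by rewrite -natrX pnatr_eq1 -(expn0 2) eqn_exp2l// gtn_eqF.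
Qed.

Lemma sphere_measure_lty : (sphere_measure (sphere R n) < +oo)%E.
Proof.
by rewrite /sphere_measure /mscale/= lte_mul_pinfty//; exact: cone_volume_sphere_lty.
Qed.

Lemma integral_sphere_measure (h : 'rV[R]_n -> \bar R) :
  measurable_fun (sphere R n) h -> (forall u, sphere R n u -> 0 <= h u)%E ->
  (\int[sphere_measure]_(u in sphere R n) h u =
   n%:R%:E * \int[cone_volume]_(u in sphere R n) h u)%E.
Proof.
by move=> mh h0; rewrite /sphere_measure ge0_integral_mscale//; exact: measurable_sphere.
Qed.

End polar_coordinates.

(** * Limits of powers *)

Section exponential_family.
Context {R : realType} d {T : measurableType d} (mu : {measure set T -> \bar R}).
Context (D : set T) (g w : T -> R) (M B : R).
Hypotheses (mD : measurable D) (muD : (mu D < +oo)%E).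
Hypotheses (mg : measurable_fun D g) (mw : measurable_fun D w).
Hypotheses (gM : forall x, D x -> `|g x| <= M) (wB : forall x, D x -> `|w x| <= B).

Let f (e : R) x := expR (e * g x) * w x.

Let mf e : measurable_fun D (f e).
Proof.
apply: measurable_funM => //; apply: measurableT_comp; first exact: measurable_expR.
by apply: measurable_funM => //; exact: measurable_cst.
Qed.

Let f_le e x : -1 < e < 1 -> D x -> `|f e x| <= expR M * B.
Proof.
move=> /andP[e1 e2] Dx; rewrite normrM ler_pM ?wB// ger0_norm ?expR_ge0//.
rewrite ler_expR (le_trans (ler_norm _))// normrM (le_trans _ (gM _ Dx))//.
by rewrite ler_piMl// ler_norml !ltW.
Qed.

Let df (e : R) x : is_derive e (1 : R) (f ^~ x) (g x * f e x).
Proof.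
have H : is_derive e (1 : R) (fun e : R => e * g x) (g x).
  have H := @is_deriveM R _ (id : R -> R) (cst (g x)) e 1 _ _
    (is_derive_id _ _) (is_derive_cst _ _ _).
  by apply: (is_derive_eq H); rewrite /GRing.scale/= mulr0 add0r mulr1.
have H2 := @is_derive1_comp R expR ( *%R^~ (g x)) e _ _ (is_derive_expR (e * g x)) H.
have H3 := @is_deriveM R _ _ (cst (w x)) e 1 _ _ H2 (is_derive_cst _ _ _).
apply: (is_derive_eq H3).
by rewrite /GRing.scale/= /f; ring.
Qed.

Lemma derivable_exponential_integral :
  derivable (fun e : R => \int[mu]_(x in D) (expR (e * g x) * w x)) 0 1.
Proof.
(* For [e] between -1 and 1 the partial derivative [g x * f e x] is dominated by a constant,
   integrable because [D] has finite measure. The absolute value makes it nonnegative even if [D] is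
   empty and [M], [B] are arbitrary. *)
apply: (@derivable_under_integral _ _ _ _ f D mD 0 (-1) 1 _ _ _
  (fun=> `|M * (expR M * B)|)) => //=.
- by rewrite in_itv/= ltrN10 ltr01.
- move=> e; rewrite in_itv/= => e1; apply: measurable_bounded_integrable => //.
  exists (expR M * B); split; first exact: num_real.
  by move=> y By x Dx /=; rewrite (le_trans (f_le _ _ e1 Dx))// ltW.
- apply: measurable_bounded_integrable => //.
  exists (`|M * (expR M * B)|); split; first exact: num_real.
  by move=> y By x Dx /=; rewrite normr_id ltW.
- move=> e x; rewrite in_itv/= => e1 Dx; rewrite partial1of2E.
  have [_ ->] := df e x; rewrite normrM; apply: le_trans (ler_norm _).
  by rewrite ler_pM// ?gM// f_le.
Qed.

End exponential_family.

Section limits.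
Context {R : realType} (G : R -> R).
Hypotheses (G0 : G 0 = 1) (dG : derivable G 0 1).

Let L : R := 'D_1 G 0.

(** As [ln (G 0) = 0], this is the difference quotient of [ln \o G] at 0. *)
Let slope_ln : h^-1 * ln (G h) @[h --> 0^'] --> L.
Proof.
have dG0 : is_derive (0 : R) (1 : R) G L by exact: derivableP.
have dln : is_derive (G 0) (1 : R) (@ln R) (G 0)^-1.
  by apply: is_derive1_ln; rewrite G0.
have [dH] := is_derive1_comp dln dG0.
rewrite G0 invr1 mul1r => <-; move: dH; rewrite /derivable /derive.
have -> : (fun h : R => h^-1 *: (((@ln R \o G) \o shift 0) (h *: (1:R)) - (@ln R \o G) 0)) =
    (fun h => h^-1 * ln (G h)).
  by apply/funext => h /=; rewrite G0 ln1 subr0 /shift/= addr0 /GRing.scale/= mulr1.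
exact.
Qed.

Let G_gt0 : \forall h \near (0 : R), 0 < G h.
Proof.
have cG : {for (0 : R), continuous G}.
  by apply: differentiable_continuous; exact/derivable1_diffP.
by apply: (cvgr_gt _ cG); rewrite G0.
Qed.

(** Common to both limits: positivity of [G (h x)] turns its powers into exponentials of multiples
    of its logarithm. *)
Lemma cvg_ln_slope {T : Type} {F : set_system T} {FF : ProperFilter F} (h : T -> R) :
  h x @[x --> F] --> 0 -> (\forall x \near F, h x != 0) ->
  (h x)^-1 * ln (G (h x)) @[x --> F] --> L /\ \forall x \near F, 0 < G (h x).
Proof.
move=> h0 hN0; split; last by have := h0 _ G_gt0.
apply: (cvg_comp h _ _ slope_ln) => A; rewrite /dnbhs => /h0 /= HA.
by apply: filterS2 HA hN0 => x; exact.
Qed.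

Lemma cvg_powR_inv : (G s^-1) `^ s @[s --> +oo] --> expR L.
Proof.
have inv0 : s^-1 @[s --> +oo] --> (0 : R).
  apply/gtr0_cvgV0; first exact: nbhs_pinfty_gt; exact: cvg_id.
have [|slope pos] := cvg_ln_slope (fun s : R => s^-1) inv0.
  by near=> s; rewrite invr_eq0 gt_eqF//; near: s; exact: nbhs_pinfty_gt.
apply: cvg_trans; last first.
  by apply: (cvg_comp _ expR slope); exact: continuous_expR.
apply: near_eq_cvg; apply: filterS pos => s Gs /=.
by rewrite /powR gt_eqF// invrK.
Unshelve. all: by end_near. Qed.

(** At [h = - (2 ^+ p)^-1] the exponent is [- h^-1], so the slope enters with the opposite sign. *)
Lemma cvg_exp_Ninv : (G (- (2 ^+ p)^-1)) ^+ (2 ^ p)%N @[p --> \oo] --> expR (- L).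
Proof.
have inv0 : - (2 ^+ p)^-1 @[p --> \oo] --> (0 : R).
  rewrite -oppr0; apply: cvgN.
  under eq_cvg do rewrite -exprVn; apply: cvg_expr.
  by rewrite ger0_norm ?invr_ge0// invf_lt1// ltr1n.
have [|slope pos] := cvg_ln_slope (fun p : nat => - (2 ^+ p)^-1) inv0.
  by near=> p; rewrite oppr_eq0 invr_eq0 expf_neq0.
apply: cvg_trans; last first.
  by apply: (cvg_comp _ expR (cvgN slope)); exact: continuous_expR.
apply: near_eq_cvg; apply: filterS pos => p Gp /=.
rewrite !fctE invrN invrK mulNr opprK -[in RHS](lnK Gp) -expRM_natl.
by rewrite natrX.
Unshelve. all: by end_near. Qed.

End limits.

(** * Affine surface areas *)

Section affine_area_integral.
Context {R : realType} {n : nat} (K : set 'rV[R]_n).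
Hypotheses (cbK : convex_body K) (K0 : K° 0) (C2K : C2_plus K).

Let measurable_normal_point_comp (h : 'rV[R]_n -> R) :
  {within boundary K, continuous h} ->
  measurable_fun (sphere R n) (fun u => h (normal_point K u)).
Proof.
move=> ch; apply: (measurability (@RGenCInfty.G R)) => [|/= _ [_] [r] -> <-].
  exact: RGenCInfty.measurableE.
rewrite (_ : _ `&` _ = [set u | sphere R n u /\ r <= h (normal_point K u)]).
  exact: closed_measurable_rV (closed_sphere_superlevel K cbK K0 C2K h r ch).
by apply/seteqP; split => u /= [Su]; rewrite in_itv/= andbT.
Qed.

Lemma measurable_curvature : measurable_fun (sphere R n) (curvature K).
Proof.
exact: measurable_normal_point_comp (continuous_gauss_curvature K cbK K0 C2K).
Qed.

Lemma measurable_support : measurable_fun (sphere R n) (Defs.support K).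
Proof.
apply: (eq_measurable_fun
    (fun u => (fun x => dotp x (gauss_map K x)) (normal_point K u))).
  move=> u /set_mem Su; rewrite (gauss_map_normal_point K cbK K0 C2K)//.
  by rewrite (support_normal_point K cbK).
exact: measurable_normal_point_comp (continuous_dotp_gauss_map K cbK K0 C2K).
Qed.

Let support_gt0 u : sphere R n u -> 0 < Defs.support K u.
Proof.
have [a [b [a0 _ H]]] := support_bounds K cbK K0 C2K.
by move=> /H/andP[+ _]; exact: lt_le_trans.
Qed.

Let curvature_gt0 u : sphere R n u -> 0 < curvature K u.
Proof.
have [a [b [a0 _ H]]] := curvature_bounds K cbK K0 C2K.
by move=> /H/andP[+ _]; exact: lt_le_trans.
Qed.

Let g u := - n%:R * (ln (curvature K u) - n.+1%:R * ln (Defs.support K u)).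
Let w u := (Defs.support K u)^-1 ^+ n.

Let mg : measurable_fun (sphere R n) g.
Proof.
apply: measurable_funM; first exact: measurable_cst.
apply: measurable_funB.
  by apply: measurableT_comp; [exact: measurable_ln|exact: measurable_curvature].
apply: measurable_funM; first exact: measurable_cst.
by apply: measurableT_comp; [exact: measurable_ln|exact: measurable_support].
Qed.

Let mVsupport : measurable_fun (sphere R n) (fun u => (Defs.support K u)^-1).
Proof.
apply: (eq_measurable_fun (fun u => Defs.support K u `^ (-1))).
  by move=> u /set_mem Su; rewrite powR_inv1// ltW// support_gt0.
apply: (measurableT_comp (f := @powR R ^~ (-1))); last exact: measurable_support.
exact: measurable_powR.
Qed.

Let mw : measurable_fun (sphere R n) w.
Proof. exact: measurable_funX. Qed.

Let ln_bounded (a b x : R) : 0 < a -> a <= x <= b -> `|ln x| <= `|ln a| + `|ln b|.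
Proof.
move=> a0 /andP[ax xb]; have x0 := lt_le_trans a0 ax.
have : ln a <= ln x by rewrite ler_ln.
have : ln x <= ln b by rewrite ler_ln// posrE (lt_le_trans x0).
have := ler_norm (ln b); have := ler_norm (- ln a).
have := normr_ge0 (ln a); have := normr_ge0 (ln b).
by rewrite normrN ler_norml => *; apply/andP; split; lra.
Qed.

Let g_bounded : exists M, forall u, sphere R n u -> `|g u| <= M.
Proof.
have [a [b [a0 _ H]]] := curvature_bounds K cbK K0 C2K.
have [a' [b' [a'0 _ H']]] := support_bounds K cbK K0 C2K.
exists (n%:R * ((`|ln a| + `|ln b|) + n.+1%:R * (`|ln a'| + `|ln b'|))) => u Su.
rewrite normrM normrN normr_nat ler_wpM2l// (le_trans (ler_normB _ _))// lerD//.
  exact: ln_bounded (H _ Su).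
by rewrite normrM normr_nat ler_wpM2l// (ln_bounded _ _ _ a'0)// H'.
Qed.

Let w_bounded : exists B, forall u, sphere R n u -> `|w u| <= B.
Proof.
have [a [b [a0 _ H]]] := support_bounds K cbK K0 C2K.
exists (a^-1 ^+ n) => u Su; have h0 := support_gt0 _ Su.
rewrite ger0_norm; last by rewrite exprn_ge0// invr_ge0 ltW.
rewrite lerXn2r ?nnegrE ?invr_ge0 ?(ltW a0) ?(ltW h0)//.
by rewrite lef_pV2//; have /andP[] := H _ Su.
Qed.

(* With [e = 1 / (n + q)], the exponent [q / (n + q)] is [1 - n e]; here
   [g = - n ln K_0] and [w = h^- n]. *)
Definition tilted_area (e : R) : R :=
  \int[sphere_measure]_(u in sphere R n) (expR (e * g u) * w u).

Lemma derivable_tilted_area : derivable tilted_area 0 1.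
Proof.
have [M gM] := g_bounded; have [B wB] := w_bounded.
apply: (derivable_exponential_integral _ _ _ _ _ M B) => //.
  exact: measurable_sphere.
exact: sphere_measure_lty.
Qed.

(** With e = 1/(n+q), one factor of the centro-affine curvature times support over curvature gives
    [w u]; the remaining power [- n e] is [expR (e * g u)]. *)
Lemma affine_areaE q : n%:R + q != 0 ->
  affine_area q K = tilted_area (n%:R + q)^-1.
Proof.
move=> nq; apply: eq_Rintegral => u /set_mem Su.
have h0 := support_gt0 _ Su; have k0 := curvature_gt0 _ Su.
rewrite /centro_affine_curvature; set c := curvature K u in k0 *.
set h := Defs.support K u in h0 *.
have hn0 : 0 < h ^+ n.+1 by rewrite exprn_gt0.
have K00 : 0 < c / h ^+ n.+1 by rewrite divr_gt0.
have -> : q / (n%:R + q) = 1 - n%:R / (n%:R + q) by field.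
have lnK0 : ln (c / h ^+ n.+1) = ln c - n.+1%:R * ln h.
  by rewrite ln_div ?posrE// lnXn// mulr_natl.
rewrite /powR gt_eqF// -/(g u) mulrBl mul1r lnK0 -{1}lnK0.
rewrite (_ : - (n%:R / (n%:R + q) * _) = (n%:R + q)^-1 * g u); last first.
  by rewrite /g; field.
rewrite expRD lnK ?posrE// mulrAC mulrC; congr (_ * _).
by rewrite /w exprS exprVn; field; rewrite !gt_eqF ?exprn_gt0.
Qed.

(** At 0 only h^-n is integrated, the n-th power of the radial function of the polar body; the
    factor n is the normalization of [sphere_measure]. *)
Lemma tilted_area0 : (0 < n)%N -> tilted_area 0 = n%:R * vol (polar K).
Proof.
move=> n0; have [a [b [a0 b0 H]]] := support_bounds K cbK K0 C2K.
pose rho u := (Defs.support K u)^-1.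
have rho_ab u : sphere R n u -> b^-1 <= rho u <= a^-1.
  move=> Su; have /andP[au ub] := H _ Su; have h0 := support_gt0 _ Su.
  by rewrite !lef_pV2// au ub.
have star_vol : lebesgue_rV n (polar K) = lebesgue_rV n (star rho (sphere R n)).
  rewrite (_ : polar K = star rho (sphere R n) `|` [set 0]).
    rewrite measureU0//; last exact: lebesgue_rV0.
      apply: (measurable_star rho mVsupport) => //; exact: measurable_sphere.
    apply: closed_measurable_rV; apply: compact_closed; last exact: compact_set1.
    exact: norm_hausdorff.
  apply/seteqP; split => y /=.
    move=> Py; have [->|y0] := eqVneq y 0; [by right|left; split].
      exact: enorm_normalize.
    exact: (polar_support K cbK K0 y y0).1.
  move=> [[Sy yh]|->]; last by move=> x _; rewrite dotpC dotp0l.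
  exact: (polar_support K cbK K0 y (normalize_sphere_neq0 _ Sy)).2.
rewrite /vol star_vol (lebesgue_star _ _ _ mVsupport _ rho_ab) ?invr_gt0//.
rewrite /tilted_area /Rintegral.
transitivity (fine (n%:R%:E * \int[@cone_volume R n]_(u in sphere R n) (rho u ^+ n)%:E)%E).
  rewrite -integral_sphere_measure; last 2 first.
  - exact/measurable_EFinP.
  - by move=> u Su; rewrite lee_fin exprn_ge0// invr_ge0 ltW// support_gt0.
  congr fine; apply: eq_integral => u _.
  by rewrite mul0r expR0 mul1r.
(* Infinite values stay infinite after multiplication by [n > 0], and [fine] sends them to 0 on both
   sides. *)
case: (\int[_]_(_ in _) _)%E => [r||] //=.
  by rewrite gt0_muley ?lte_fin ?ltr0n// mulr0.
by rewrite gt0_muleNy ?lte_fin ?ltr0n// mulr0.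
Qed.

End affine_area_integral.

Theorem theorem3p2 (R : realType) (n : nat) (K : set 'rV[R]_n) :
  (2 <= n)%N -> convex_body K -> K° 0 -> C2_plus K ->
  let a := fun p : nat =>
    (affine_area (- (n%:R + 2 ^+ p)) K / (n%:R * vol (polar K))) ^+ (2 ^ p)%N in
  cvgn a /\ limn a = (paouris_werner K)^-1.
Proof.
move=> n2 cbK K0 C2K a; have n0 : (0 < n)%N by exact: ltnW.
set V := n%:R * vol (polar K).
have nq_pinfty : n%:R + q @[q --> +oo] --> (+oo : set_system R).
  apply/cvgryPge => A; near=> q; rewrite ler_wpDl//; near: q.
have nq_gt0 : \forall q \near +oo, 0 < n%:R + q :> R.
  exact: (cvgryPgt _).1 nq_pinfty 0.
(* [x / 0 = 0]: if [V] vanished, both limits would be [0]. *)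
have [V0|V0] := eqVneq V 0.
  have a0 : a @ \oo --> (0 : R).
    apply: cvg_near_cst; apply: nearW => p.
    by rewrite /a -/V V0 invr0 mulr0 expr0n expn_eq0.
  have pw0 : paouris_werner K = 0.
    apply/cvg_lim => //; apply: cvg_near_cst.
    apply: filterS nq_gt0 => q nq0 /=.
    by rewrite -/V V0 invr0 mulr0 powR0// gt_eqF.
  by split; [apply/cvg_ex; exists 0|rewrite pw0 invr0; exact/cvg_lim].
pose G e := tilted_area K e / V.
have G0 : G 0 = 1 by rewrite /G tilted_area0// divff.
have dG : derivable G 0 1.
  exact: derivableM (derivable_tilted_area K cbK K0 C2K) (derivable_cst _ _ _).
have pwL : paouris_werner K = expR ('D_1 G 0).
  apply: cvg_lim; first exact: norm_hausdorff.
  have cG := cvg_comp (fun q => n%:R + q) _ nq_pinfty (cvg_powR_inv G G0 dG).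
  apply: cvg_trans cG; apply: near_eq_cvg; apply: filterS nq_gt0 => q nq0 /=.
  by rewrite affine_areaE// gt_eqF.
have aL : a @ \oo --> expR (- 'D_1 G 0).
  have cG := cvg_exp_Ninv G G0 dG.
  (* Here [n + q = - 2 ^+ p], which is nonzero, so the parameter of the exponential integral is
     [- (2 ^+ p)^-1]. *)
  have aE p : affine_area (- (n%:R + 2 ^+ p)) K = tilted_area K (- (2 ^+ p)^-1).
    have E : n%:R - (n%:R + 2 ^+ p) = - 2 ^+ p :> R by rewrite opprD addNKr.
    have E0 : - 2 ^+ p != 0 :> R by rewrite oppr_eq0 expf_neq0// pnatr_eq0.
    have En : n%:R - (n%:R + 2 ^+ p) != 0 :> R by rewrite E.
    by rewrite (affine_areaE K cbK K0 C2K _ En) E invrN.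
  rewrite (_ : a = fun p => G (- (2 ^+ p)^-1) ^+ (2 ^ p)%N)//.
  by apply/funext => p; rewrite /a aE.
split; first by apply/cvg_ex; exists (expR (- 'D_1 G 0)).
by rewrite pwL -expRN; exact/cvg_lim.
Unshelve. all: by end_near. Qed.
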